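(* Let $G$ be a triangle-critical claw-free graph with $\chi(G) = 12$. Then $G$ is a complete graph (i.e. $G \cong K_{12}$).
   Context: All graphs are finite and simple. $\chi(G)$ denotes the chromatic number. A graph is claw-free if it has no induced subgraph isomorphic to $K_{1,3}$. For $\ell \geq 2$, a graph $G$ is called $K_{\ell}$-critical if (i) $G$ contains $K_{\ell}$ as a subgraph; (ii) $G$ is critical, i.e. removing any vertex reduces the chromatic number of $G$ by one; (iii) removing the vertex set of any copy of $K_{\ell}$ in $G$ reduces the chromatic number of $G$ by exactly $\ell$. A graph is triangle-critical if it is $K_3$-critical. *)

(* Defs.v *)
From mathcomp Require Import all_boot.
Set Implicit Arguments.
Unset Strict Implicit.
Unset Printing Implicit Defensive.

Record sgraph := SGraph {
  vertex :> finType;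
  edge : rel vertex;
  edge_sym : symmetric edge;
  edge_irr : irreflexive edge
}.

Section Complete.
Variable n : nat.
Definition complete_rel : rel 'I_n := fun i j => i != j.
Lemma complete_sym : symmetric complete_rel.
Proof. by move=> i j; rewrite /complete_rel eq_sym. Qed.
Lemma complete_irr : irreflexive complete_rel.
Proof. by move=> i; rewrite /complete_rel eqxx. Qed.
Definition complete : sgraph := SGraph complete_sym complete_irr.
End Complete.

Section CompleteBipartite.
Variables m n : nat.
Definition bipartite_rel : rel ('I_m + 'I_n)%type := fun u v =>
  match u, v with inl _, inr _ | inr _, inl _ => true | _, _ => false end.
Lemma bipartite_sym : symmetric bipartite_rel.
Proof. by case=> i [] j. Qed.
Lemma bipartite_irr : irreflexive bipartite_rel.
Proof. by case. Qed.
Definition complete_bipartite : sgraph := SGraph bipartite_sym bipartite_irr.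
End CompleteBipartite.

Section Induced.
Variables (G : sgraph) (S : {set G}).
Definition induced_rel : rel {x : G | x \in S} :=
  fun u v => edge (val u) (val v).
Lemma induced_sym : symmetric induced_rel.
Proof. by move=> u v; apply: edge_sym. Qed.
Lemma induced_irr : irreflexive induced_rel.
Proof. by move=> u; apply: edge_irr. Qed.
Definition induced : sgraph := SGraph induced_sym induced_irr.
End Induced.

Definition remove (G : sgraph) (S : {set G}) : sgraph := induced (~: S).

Definition isomorphic (G H : sgraph) : Prop :=
  exists f : G -> H, bijective f /\ forall x y, edge (f x) (f y) = edge x y.

(* [f] exhibits a copy of [H] as a not necessarily induced subgraph of [G];
   the vertex set of that copy is [f @: [set: H]]. *)
Definition subgraph_embedding (H G : sgraph) (f : H -> G) : Prop :=
  injective f /\ forall x y, edge x y -> edge (f x) (f y).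

Definition colorable (G : sgraph) (k : nat) : bool :=
  [exists c : {ffun G -> 'I_k},
     [forall x, forall y, edge x y ==> (c x != c y)]].

Lemma colorable_ex (G : sgraph) : exists k, colorable G k.
Proof.
exists #|G|; apply/existsP; exists [ffun x => enum_rank x].
apply/forallP => x; apply/forallP => y; apply/implyP; rewrite !ffunE.
by apply: contraTneq => /enum_rank_inj ->; rewrite edge_irr.
Qed.

Definition chi (G : sgraph) : nat := ex_minn (colorable_ex G).

Definition claw_free (G : sgraph) : Prop :=
  forall S : {set G}, ~ isomorphic (induced S) (complete_bipartite 1 3).

Definition critical (G : sgraph) : Prop :=
  forall v : G, chi (remove [set v]) + 1 = chi G.

Definition clique_critical (l : nat) (G : sgraph) : Prop :=
  [/\ exists f : complete l -> G, subgraph_embedding f,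
      critical G
    & forall f : complete l -> G, subgraph_embedding f ->
        chi (remove (f @: [set: complete l])) + l = chi G].

Definition triangle_critical (G : sgraph) : Prop := clique_critical 3 G.

(* Main.v *)
(** The neighbourhood N(v) of a vertex v of a claw-free graph contains no three
    pairwise non-adjacent vertices, so non-adjacency inside N(v) is a
    triangle-free graph f on N(v).  Suppose G has no clique of size 12.  In a
    9-colouring of G - T, for a triangle T, each class contains a vertex complete
    to T, since otherwise G would be 11-colourable.  Hence for f-non-adjacent a, b
    in N(v), the union U of their f-neighbourhoods satisfies |U| + 11 <= |N(v)|,
    and it is matched into its complement; moreover the non-isolated f-degrees are
    at least 3, and cliques have at most 9 vertices.  It follows that f is never
    bipartite: two f-non-adjacent vertices on opposite sides have disjoint
    f-neighbourhoods, so |N(v)| >= 17 and one side has at least 9 vertices.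

    If u is not adjacent to s, claw-freeness makes each vertex of N(s) /\ N(u)
    f-adjacent to exactly one end of every f-edge of N(s) outside N(u).  Take a
    maximum stable set S with |S| >= 3.  Counting with these splitting sets shows
    that each s in S has exactly one partner u in S for which N(s) /\ N(u) is not a
    clique.  Then N(s) /\ N(u) is empty unless u is the partner of s, for all
    maximum stable sets S, which contradicts the connectedness of G.  If G has no
    stable set of size 3, colourings are matchings of the complement, and Gallai's
    exchange argument applies. *)
Require Import Defs.
From mathcomp Require Import all_boot zify.
Set Implicit Arguments.
Unset Strict Implicit.
Unset Printing Implicit Defensive.

(** * Local non-adjacency graphs *)

Section LocalGraph.
Variables (T : finType) (f : rel T).

Definition nb (x : T) : {set T} := [set y | f x y].
Definition nonisolated : {set T} := [set x | nb x != set0].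
Definition independent (A : {set T}) : Prop := {in A &, forall x y, ~~ f x y}.

(* The clauses satisfied by non-adjacency [f] in the neighbourhood [N] of a
   vertex; [f]-independent sets are the cliques of [N]. *)
Record local_graph (N : {set T}) : Prop := LocalGraph {
  local_sym : symmetric f;
  local_dom : forall x y, f x y -> x \in N;
  local_triangle_free : forall x y z, f x y -> f y z -> f x z -> False;
  local_degree : forall x y, f x y -> 3 <= #|nb x|;
  local_union : forall a b, a \in N -> b \in N -> a != b -> ~~ f a b ->
    #|nb a :|: nb b| + 11 <= #|N|;
  local_double_union : forall a b x y, f a x -> f b y -> a != b -> ~~ f a b ->
    #|nb a :|: nb b|.*2 + 2 <= #|nonisolated|;
  local_independent : forall I : {set T}, I \subset N -> independent I ->
    #|I| <= 8;
  local_card : 11 <= #|N|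
}.

(** Claw-freeness gives this property to the common neighbourhood of a vertex with any of its
    non-neighbours; see [splits_common]. *)
Definition splits (X : {set T}) : Prop :=
  forall w z z', w \in X -> z \notin X -> z' \notin X -> f z z' ->
    f w z = ~~ f w z'.

Variable N : {set T}.
Hypothesis lg : local_graph N.
Let fC := local_sym lg.

Lemma nonisolatedP x : reflect (exists y, f x y) (x \in nonisolated).
Proof.
rewrite inE; apply: (iffP (set0Pn _)) => -[y]; rewrite ?inE => h; exists y => //.
by rewrite inE.
Qed.

Lemma local_no_triangle x y z : f x y -> f y z -> f x z = false.
Proof. by move=> xy yz; apply/negP => xz; apply: (local_triangle_free lg xy yz xz). Qed.

(** Both sides are [f]-independent, so [N] has at most 16 vertices, while two non-adjacent
    non-isolated vertices on opposite sides have disjoint neighbourhoods and force 17. Hence the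
    non-isolated vertices form a complete bipartite graph, where [local_double_union] makes each
    side smaller than the other. *)
Lemma local_not_bipartite (c : pred T) :
  (forall x y, f x y -> c x != c y) -> False.
Proof.
move=> hc.
have [/existsP[x /existsP[y xy]] | /existsPn noedge] :=
  boolP [exists x, exists y, f x y]; last first.
  have : #|N| <= 8.
    apply: (local_independent lg) => // x y _ _.
    by move/existsPn: (noedge x) => /(_ y).
  have := local_card lg; lia.
have indep b : independent [set z in N | c z == b].
  move=> a d; rewrite !inE => /andP[_ /eqP ca] /andP[_ /eqP cd].
  by apply/negP => /hc; rewrite ca cd eqxx.
have cardN : #|N| <= 16.
  have -> : N = [set z in N | c z == true] :|: [set z in N | c z == false].
    by apply/setP => z; rewrite !inE; case: (z \in N) (c z) => [] [].
  rewrite cardsU.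
  have le8 b : #|[set z in N | c z == b]| <= 8.
    apply: (local_independent lg) (indep b).
    by apply/subsetP => z; rewrite inE => /andP[].
  have := le8 true; have := le8 false; lia.
pose P b := [set z in nonisolated | c z == b].
have [/existsP[a /existsP[b /and3P[aP bP nab]]] | /existsPn full] :=
  boolP [exists a, exists b, [&& a \in P true, b \in P false & ~~ f a b]].
  move: aP bP; rewrite !inE -!/(nb _) => /andP[/set0Pn[a'] + /eqP ca].
  rewrite inE => aa' /andP[/set0Pn[b'] +  /eqP cb]; rewrite inE => bb'.
  have neq : a != b by apply/eqP => E; rewrite E cb in ca.
  have := local_union lg (local_dom lg aa') (local_dom lg bb') neq nab.
  rewrite cardsU (_ : nb a :&: nb b = set0) ?cards0.
    have := local_degree lg aa'; have := local_degree lg bb'; lia.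
  apply/setP => z; rewrite !inE; apply/negP => /andP[/hc + /hc].
  by rewrite ca cb; case: (c z).
have complete a b : a \in P true -> b \in P false -> f a b.
  move=> ha hb; apply/negPn/negP => nab.
  by move/existsPn: (full a) => /(_ b); rewrite ha hb nab.
have cross b0 a b : a \in P b0 -> b \in P (~~ b0) -> f a b.
  case: b0 => ha hb; first exact: complete.
  by rewrite fC; apply: complete.
have cardP : #|nonisolated| = #|P true| + #|P false|.
  rewrite -(cardsID [set z | c z]); congr (_ + _); apply: eq_card => z.
    by rewrite !inE; case: (c z); rewrite ?andbT ?andbF.
  by rewrite !inE; case: (c z); rewrite ?andbT ?andbF.
have big b0 : #|P (~~ b0)|.*2 + 2 <= #|nonisolated|.
  have [u [w [uw cu]]] : exists u w, f u w /\ c u = ~~ b0.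
    have := hc _ _ xy; case: (c x =P ~~ b0) => [cx _|]; first by exists x, y.
    move=> cx cxy; exists y, x; rewrite fC; split=> //.
    by move: cx cxy; case: (c x) (c y) b0 => [] [] [].
  have nbu : nb u \subset P b0.
    apply/subsetP => z; rewrite inE => uz; rewrite inE.
    apply/andP; split; first by apply/nonisolatedP; exists u; rewrite fC.
    by have := hc _ _ uz; rewrite cu; case: (c z) b0 {cu} => [] [].
  have : 1 < #|nb u| by apply: leq_trans (local_degree lg uw).
  case/card_gt1P => a [b [ua ub neq]].
  have aP := subsetP nbu _ ua; have bP := subsetP nbu _ ub.
  move: (ua) (ub); rewrite !inE => ua' ub'.
  have nab : ~~ f a b by rewrite (@local_no_triangle a u b) // fC.
  apply: leq_trans (local_double_union lg (x := u) (y := u) _ _ neq nab); rewrite 1?fC //.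
  rewrite leq_add2r leq_double; apply: subset_leq_card.
  by apply/subsetP => z zP; rewrite !inE (cross b0 a).
have := big true; have := big false; rewrite cardP /=; lia.
Qed.

(** After renaming, [p q q' p'] is a 4-cycle without diagonals. By splitting, every non-isolated
    vertex sees one of the four, while [local_double_union] on the two missing diagonals leaves at
    least two vertices uncovered. *)
Lemma two_dependent_splits_contra (X1 X2 : {set T}) p q p' q' :
  splits X1 -> splits X2 -> [disjoint X1 & X2] ->
  p \in X1 -> q \in X1 -> f p q -> p' \in X2 -> q' \in X2 -> f p' q' -> False.
Proof.
move=> s1 s2 dis pX qX pq.
have n2 z : z \in X1 -> z \notin X2 by move/(disjointFr dis) ->.
have n1 z : z \in X2 -> z \notin X1 by move/(disjointFl dis) ->.
wlog pp' : p' q' / f p p'.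
  move=> gen p'X q'X p'q'; case: (boolP (f p p')) => [h|]; first exact: (gen p' q').
  rewrite (s1 _ _ _ pX (n1 _ p'X) (n1 _ q'X) p'q') negbK => h.
  by apply: (gen q' p'); rewrite // fC.
move=> p'X q'X p'q'.
have npq' : f p q' = false by exact: local_no_triangle pp' p'q'.
have nqp' : f q p' = false by rewrite fC; apply: (@local_no_triangle _ p); rewrite // fC.
have qq' : f q q'.
  have qp : f q p by rewrite fC.
  by rewrite fC (s2 _ _ _ q'X (n2 _ qX) (n2 _ pX) qp) fC npq'.
have npq : p != q' by apply: contraTneq pX => ->; apply: n1.
have nqp : q != p' by apply: contraTneq qX => ->; apply: n1.
have q'p' : f q' p' by rewrite fC.
have qp : f q p by rewrite fC.
have U1 := local_double_union lg pq q'p' npq (negbT npq').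
have U2 := local_double_union lg qp p'q' nqp (negbT nqp').
have cover : nonisolated \subset (nb p :|: nb q') :|: (nb q :|: nb p').
  apply/subsetP => z /nonisolatedP[g zg].
  have [zX1|zX1] := boolP (z \in X1).
    have := s1 _ _ _ zX1 (n1 _ p'X) (n1 _ q'X) p'q'.
    by rewrite !inE !(fC _ z) => ->; case: (f z q'); rewrite ?orbT.
  have [zX2|zX2] := boolP (z \in X2).
    have := s2 _ _ _ zX2 (n2 _ pX) (n2 _ qX) pq.
    by rewrite !inE !(fC _ z) => ->; case: (f z q); rewrite ?orbT.
  (* [g] lies outside [X1] or outside [X2]; both ends of the edge inside that set then see [g],
     which closes a triangle. *)
  rewrite !inE; apply/negPn/negP; rewrite !negb_or => /andP[/andP[zp zq'] /andP[zq zp']].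
  have [gX1|gX1] := boolP (g \in X1).
    have gX2 := n2 _ gX1.
    have := s2 _ _ _ p'X zX2 gX2 zg; rewrite (negbTE zp') => /esym/negbFE p'g.
    have := s2 _ _ _ q'X zX2 gX2 zg; rewrite (negbTE zq') => /esym/negbFE q'g.
    by apply: (local_triangle_free lg p'q' q'g p'g).
  have := s1 _ _ _ pX zX1 gX1 zg; rewrite (negbTE zp) => /esym/negbFE pg.
  have := s1 _ _ _ qX zX1 gX1 zg; rewrite (negbTE zq) => /esym/negbFE qg.
  by apply: (local_triangle_free lg pq qg pg).
have := leq_trans (subset_leq_card cover) (leq_card_setU _ _).
move: U1 U2; clear; lia.
Qed.

End LocalGraph.

(** * Splitting sets *)

Section SplittingSets.
Variables (T : finType) (f : rel T).
Variable N : {set T}.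
Hypothesis lg : local_graph f N.
Let fC := local_sym lg.
Local Notation nb := (nb f).
Local Notation splits := (splits f).
Local Notation independent := (independent f).

(* With [w1] adjacent to [w2] and [w3], the neighbourhoods of [w2] (off [X2])
   and of [w3] (on [X2]) are the two halves of a proper 2-colouring. *)
Lemma three_splitting_path (X1 X2 X3 : {set T}) w1 w2 w3 :
  splits X1 -> splits X2 -> splits X3 ->
  [disjoint X1 & X2] -> [disjoint X1 & X3] -> [disjoint X2 & X3] ->
  w1 \in X1 -> w2 \in X2 -> w3 \in X3 -> f w1 w2 -> f w1 w3 -> False.
Proof.
move=> s1 s2 s3 d12 d13 d23 w1X w2X w3X w12 w13.
have n23 : f w2 w3 = false by apply: (local_no_triangle lg (y := w1)); rewrite // fC.
have w2X1 : w2 \notin X1 by rewrite (disjointFl d12).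
have w2X3 : w2 \notin X3 by rewrite (disjointFr d23).
have w3X1 : w3 \notin X1 by rewrite (disjointFl d13).
have w3X2 : w3 \notin X2 by rewrite (disjointFl d23).
have w1X2 : w1 \notin X2 by rewrite (disjointFr d12).
have w1X3 : w1 \notin X3 by rewrite (disjointFr d13).
pose c z := if z \in X2 then f w3 z else f w2 z.
(* Edges across the boundary of [X2]: a vertex of [X2] sees exactly one of [w1], [w3], and a vertex
   outside [X2] and [X3] sees both or neither of [w2], [w3]. *)
have mixed z z' : z \in X2 -> z' \notin X2 -> f z z' -> f w3 z != f w2 z'.
  move=> zX z'X zz'.
  have zX1 : z \notin X1 by rewrite (disjointFl d12).
  have zX3 : z \notin X3 by rewrite (disjointFr d23).
  have z13 : f w1 z = ~~ f w3 z.
    by have := s2 _ _ _ zX w1X2 w3X2 w13; rewrite !(fC z).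
  have [z'X3|z'X3] := boolP (z' \in X3).
    have z'X1 : z' \notin X1 by rewrite (disjointFl d13).
    have z'12 : f w1 z' = ~~ f w2 z'.
      by have := s3 _ _ _ z'X3 w1X3 w2X3 w12; rewrite !(fC z').
    have := s1 _ _ _ w1X zX1 z'X1 zz'; rewrite z13 z'12 negbK => <-.
    by case: (f w3 z).
  have e3 := s3 _ _ _ w3X zX3 z'X3 zz'.
  suff -> : f w2 z' = f w3 z' by rewrite e3; case: (f w3 z').
  apply/idP/idP => h.
    have := s3 _ _ _ w3X z'X3 w2X3; rewrite fC => /(_ h).
    by rewrite [f w3 w2]fC n23.
  have := s2 _ _ _ w2X z'X w3X2; rewrite fC => /(_ h).
  by rewrite n23.
apply: (local_not_bipartite lg (c := c)) => x y xy; rewrite /c.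
have [xX|xX] := boolP (x \in X2); have [yX|yX] := boolP (y \in X2).
- rewrite (s3 _ _ _ w3X _ _ xy) ?(disjointFr d23) //; by case: (f w3 y).
- exact: mixed.
- by rewrite eq_sym; apply: mixed; rewrite // fC.
- rewrite (s2 _ _ _ w2X xX yX xy); by case: (f w2 y).
Qed.

(** [w3] splits the edge [w1 w2], so it sees one end, which becomes the middle of a path through the
    three sets. *)
Lemma three_splitting_edge (X1 X2 X3 : {set T}) w1 w2 w3 :
  splits X1 -> splits X2 -> splits X3 ->
  [disjoint X1 & X2] -> [disjoint X1 & X3] -> [disjoint X2 & X3] ->
  w1 \in X1 -> w2 \in X2 -> w3 \in X3 -> f w1 w2 -> False.
Proof.
move=> s1 s2 s3 d12 d13 d23 w1X w2X w3X w12.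
have [w31|] := boolP (f w3 w1).
  by apply: (three_splitting_path s1 s2 s3 d12 d13 d23 w1X w2X w3X); rewrite // fC.
have w1X3 : w1 \notin X3 by rewrite (disjointFr d13).
have w2X3 : w2 \notin X3 by rewrite (disjointFr d23).
rewrite (s3 _ _ _ w3X w1X3 w2X3 w12) negbK => w32.
rewrite disjoint_sym in d12.
by apply: (three_splitting_path s2 s1 s3 d12 d23 d13 w2X w1X w3X); rewrite // fC.
Qed.

(** * Neighbourhoods covered by three cliques *)

Definition rest (X1 X2 : {set T}) : {set T} := N :\: (X1 :|: X2).
Definition full (X1 X2 : {set T}) : {set T} :=
  [set e in rest X1 X2 | (nb e :&: X1 != set0) && (nb e :&: X2 != set0)].

(** The situation at a member of a maximum stable set that has no partner: [X1] and [X2] are its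
    common neighbourhoods with two other members, and [rest] consists of its private neighbours. *)
Record three_parts (X1 X2 : {set T}) : Prop := ThreeParts {
  parts_sub1 : X1 \subset N;
  parts_sub2 : X2 \subset N;
  parts_split1 : splits X1;
  parts_split2 : splits X2;
  parts_disjoint : [disjoint X1 & X2];
  parts_indep1 : independent X1;
  parts_indep2 : independent X2;
  parts_indep_rest : independent (rest X1 X2)
}.

Lemma restC X1 X2 : rest X1 X2 = rest X2 X1.
Proof. by rewrite /rest setUC. Qed.

Lemma fullC X1 X2 : full X1 X2 = full X2 X1.
Proof. by apply/setP => e; rewrite [LHS]inE [RHS]inE restC; congr andb; rewrite andbC. Qed.

Lemma three_partsC X1 X2 : three_parts X1 X2 -> three_parts X2 X1.
Proof.
by case=> *; split=> //; rewrite 1?restC // disjoint_sym.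
Qed.

Lemma rest_notin1 X1 X2 e : e \in rest X1 X2 -> e \notin X1.
Proof. by rewrite !inE negb_or => /andP[/andP[]]. Qed.

Lemma rest_notin2 X1 X2 e : e \in rest X1 X2 -> e \notin X2.
Proof. by rewrite !inE negb_or => /andP[/andP[]]. Qed.

Lemma full_rest X1 X2 e : e \in full X1 X2 -> e \in rest X1 X2.
Proof. by rewrite inE => /andP[]. Qed.

Lemma full_nb1 X1 X2 e : e \in full X1 X2 -> exists2 x, x \in X1 & f e x.
Proof.
rewrite inE => /and3P[_ /set0Pn[x]]; rewrite !inE => /andP[ex xX] _.
by exists x.
Qed.

Lemma full_nb2 X1 X2 e : e \in full X1 X2 -> exists2 x, x \in X2 & f e x.
Proof. rewrite fullC; exact: full_nb1. Qed.

Lemma nb_rest X1 X2 e : three_parts X1 X2 -> e \in rest X1 X2 ->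
  nb e \subset X1 :|: X2.
Proof.
move=> h eE; apply/subsetP => z; rewrite inE => ez.
have zN : z \in N by apply: (local_dom lg (y := e)); rewrite fC.
apply/negPn/negP => zX.
by have := parts_indep_rest h eE (_ : z \in rest X1 X2); rewrite ez !inE -in_setU zX zN => /(_ isT).
Qed.

Lemma rest_edge X1 X2 e x y : three_parts X1 X2 -> e \in rest X1 X2 ->
  x \in X1 -> f e x -> y \in X2 -> f y e = ~~ f y x.
Proof.
move=> h eE xX ex yX; apply: (parts_split2 h) => //.
  exact: rest_notin2 eE.
by rewrite (disjointFr (parts_disjoint h)).
Qed.

Lemma full_agree X1 X2 e e' g y : three_parts X1 X2 ->
  e \in rest X1 X2 -> e' \in rest X1 X2 -> g \in X1 -> f e g -> f e' g ->
  y \in X2 -> f e y = f e' y.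
Proof.
move=> h eE e'E gX eg e'g yX; rewrite !(fC _ y).
by rewrite (rest_edge h eE gX eg yX) (rest_edge h e'E gX e'g yX).
Qed.

(** If [g] is in [X1], each vertex of [X2] splits both [e g] and [e' g], so [e] and [e'] agree on
    [X2]. As [e] is full, they share a neighbour there, and the same argument from it gives
    agreement on [X1]. *)
Lemma full_nb_eq X1 X2 e e' g : three_parts X1 X2 ->
  e \in full X1 X2 -> e' \in full X1 X2 -> f e g -> f e' g -> nb e = nb e'.
Proof.
move=> h.
wlog gX : X1 X2 h / g \in X1.
  move=> gen eF e'F eg e'g.
  have : g \in X1 :|: X2.
    by apply: (subsetP (nb_rest h (full_rest eF))); rewrite inE.
  rewrite inE => /orP[gX|gX]; first exact: (gen X1 X2).
  by apply: (gen X2 X1) => //; [apply: three_partsC | rewrite fullC | rewrite fullC].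
move=> eF e'F eg e'g.
have eE := full_rest eF; have e'E := full_rest e'F.
have ag2 y : y \in X2 -> f e y = f e' y by exact: full_agree h eE e'E gX eg e'g.
have [y yX ey] := full_nb2 eF.
have ag1 x : x \in X1 -> f e x = f e' x.
  apply: (full_agree (three_partsC h) _ _ yX ey); rewrite 1?restC //.
  by rewrite -ag2.
apply/setP => z; rewrite !inE.
have [zX|zX] := boolP (z \in X1 :|: X2).
  by move: zX; rewrite inE => /orP[]; [apply: ag1 | apply: ag2].
apply/idP/idP => ez; case/negP: zX.
  by apply: (subsetP (nb_rest h eE)); rewrite inE.
by apply: (subsetP (nb_rest h e'E)); rewrite inE.
Qed.

(** Let [x], [y] be neighbours of [e] in [X1], [X2]. A vertex of [X1] that misses [e] splits [e y],
    hence sees [y]; likewise for [X2] and [x]. Twins of [e] see [x]. Then [local_union] applies to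
    [x] and [y]. *)
Lemma full_class_bound X1 X2 e : three_parts X1 X2 -> e \in full X1 X2 ->
  #|X1 :|: X2| + #|[set e' in full X1 X2 | nb e' == nb e]| + 11 <= #|N| + #|nb e|.
Proof.
move=> h eF; have eE := full_rest eF.
have [x xX ex] := full_nb1 eF; have [y yX ey] := full_nb2 eF.
have nxy : ~~ f x y by rewrite (local_no_triangle lg (y := e)) // fC.
have neq : x != y.
  by apply: contraTneq xX => ->; rewrite (disjointFl (parts_disjoint h)).
have xN := subsetP (parts_sub1 h) _ xX; have yN := subsetP (parts_sub2 h) _ yX.
have U := local_union lg xN yN neq nxy.
set K := [set _ in _ | _].
have sub : ((X1 :|: X2) :\: nb e) :|: K \subset nb x :|: nb y.
  apply/subsetP => z; rewrite in_setU => /orP[|]; last first.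
    rewrite inE => /andP[_ /eqP E]; rewrite !inE.
    have : x \in nb z by rewrite E inE.
    by rewrite inE fC => ->.
  rewrite !inE => /andP[nez /orP[zX|zX]].
    have := rest_edge (three_partsC h) _ yX ey zX; rewrite restC => /(_ eE).
    by rewrite !(fC _ z) in nez *; rewrite (negbTE nez) => /esym/negbFE ->; rewrite orbT.
  have := rest_edge h eE xX ex zX.
  by rewrite !(fC _ z) in nez *; rewrite (negbTE nez) => /esym/negbFE ->.
have dis : ((X1 :|: X2) :\: nb e) :&: K = set0.
  apply/setP => z; rewrite in_setI in_set0; apply/negP => /andP[].
  rewrite in_setD in_setU => /andP[_ zX]; rewrite inE => /andP[/full_rest zE _].
  by move: zX; rewrite (negbTE (rest_notin1 zE)) (negbTE (rest_notin2 zE)).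
have := subset_leq_card sub; rewrite cardsU dis cards0 subn0.
have : #|X1 :|: X2| <= #|(X1 :|: X2) :\: nb e| + #|nb e|.
  rewrite -[X in X <= _](cardsID (nb e)) addnC leq_add2l.
  by apply: subset_leq_card; apply: subsetIr.
move: U; clear; lia.
Qed.

Lemma full_sum_bound X1 X2 : three_parts X1 X2 ->
  #|nb @: full X1 X2| * #|X1 :|: X2| + #|full X1 X2| + 11 * #|nb @: full X1 X2|
    <= #|nb @: full X1 X2| * #|N| + \sum_(B in nb @: full X1 X2) #|B|.
Proof.
move=> h; set R := nb @: _.
have -> : #|full X1 X2| = \sum_(B in R) #|[set e in full X1 X2 | nb e == B]|.
  rewrite -sum1_card (partition_big_imset nb) /=; apply: eq_bigr => B _.
  by rewrite -sum1_card; apply: eq_bigl => e; rewrite !inE.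
rewrite (mulnC 11) -!sum_nat_const -!big_split /=; apply: leq_sum => B.
by case/imsetP => e eF ->; apply: full_class_bound.
Qed.

(** Distinct neighbourhoods of full vertices are disjoint by [full_nb_eq]; [H] reserves room in
    [X1 :|: X2] that they cannot use. *)
Lemma full_sum_card X1 X2 (H : {set T}) : three_parts X1 X2 ->
  H \subset X1 :|: X2 -> (forall e, e \in full X1 X2 -> [disjoint H & nb e]) ->
  \sum_(B in nb @: full X1 X2) #|B| + #|H| <= #|X1 :|: X2|.
Proof.
move=> h HX dH; set R := nb @: _.
have tR : trivIset R.
  apply/trivIsetP => _ _ /imsetP[e eF ->] /imsetP[e' e'F ->] neq.
  apply/pred0P => g /=; apply/negP => /andP[]; rewrite !inE => eg e'g.
  by rewrite (full_nb_eq h eF e'F eg e'g) eqxx in neq.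
move/eqP: tR => ->.
have dis : cover R :&: H = set0.
  apply/setP => z; rewrite in_setI in_set0; apply/negP => /andP[].
  case/bigcupP => _ /imsetP[e eF ->] ze zH.
  by rewrite (disjointFr (dH e eF) zH) in ze.
have := cardsU (cover R) H; rewrite dis cards0 subn0 => <-.
apply: subset_leq_card; rewrite subUset HX andbT.
by apply/bigcupsP => _ /imsetP[e eF ->]; apply: nb_rest h (full_rest eF).
Qed.

Lemma rest_isolated_card X1 X2 : three_parts X1 X2 ->
  #|X1| + #|[set e in rest X1 X2 | nb e :&: X1 == set0]| <= 8.
Proof.
move=> h; set E1 := [set _ in _ | _].
have dis : X1 :&: E1 = set0.
  apply/setP => z; rewrite in_setI in_set0; apply/negP => /andP[zX].
  by rewrite inE => /andP[/rest_notin1]; rewrite zX.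
have := cardsU X1 E1; rewrite dis cards0 subn0 => <-.
apply: (local_independent lg).
  rewrite subUset (parts_sub1 h) /=; apply/subsetP => e.
  by rewrite !inE => /andP[/andP[_ ->]].
have E1X e x : e \in E1 -> x \in X1 -> ~~ f e x.
  rewrite inE => /andP[_ /eqP E] xX; apply/negP => ex.
  by move/setP: E => /(_ x); rewrite !inE ex xX.
move=> a b; rewrite !(in_setU _ X1) => /orP[aX|aE] /orP[bX|bE].
- exact: (parts_indep1 h).
- by rewrite fC E1X.
- exact: E1X.
- by apply: (parts_indep_rest h); [move: aE | move: bE]; rewrite inE => /andP[].
Qed.

Lemma rest_card X1 X2 : three_parts X1 X2 ->
  [/\ #|N| = #|X1 :|: X2| + #|rest X1 X2|, #|X1 :|: X2| = #|X1| + #|X2| &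
      #|rest X1 X2| <= 8].
Proof.
move=> h; split.
- rewrite -(cardsID (X1 :|: X2) N); congr (_ + _).
  by rewrite (setIidPr _) // subUset (parts_sub1 h) (parts_sub2 h).
- by rewrite cardsU (disjoint_setI0 (parts_disjoint h)) cards0 subn0.
- by apply: (local_independent lg (subsetDl _ _)); apply: parts_indep_rest.
Qed.

(** For the disjointness: a neighbour in [X2] of a full [e] misses [h0], so by splitting it sees
    every common neighbour of [e] and [h0], closing a triangle. *)
Lemma half_nb X1 X2 h0 x : three_parts X1 X2 -> h0 \in rest X1 X2 ->
  nb h0 :&: X2 == set0 -> f h0 x ->
  [/\ 3 <= #|nb h0|, nb h0 \subset X1 &
      forall e, e \in full X1 X2 -> [disjoint nb h0 & nb e]].
Proof.
move=> h hE /eqP h2 hx.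
have out2 y : y \in X2 -> f h0 y = false.
  move=> yX; apply/negP => hy.
  by move/setP: h2 => /(_ y); rewrite !inE hy yX.
have sub1 : nb h0 \subset X1.
  apply/subsetP => z; rewrite inE => hz.
  have : z \in X1 :|: X2 by apply: (subsetP (nb_rest h hE)); rewrite inE.
  by rewrite inE => /orP[] // /out2; rewrite hz.
split=> [|//|]; first exact: (local_degree lg hx).
move=> e eF; apply/pred0P => g /=; apply/negP => /andP[gh].
have gX := subsetP sub1 _ gh.
move: gh; rewrite !inE => hg eg; have [y yX ey] := full_nb2 eF.
have := rest_edge h hE gX hg yX; rewrite fC out2 // => /esym/negbFE yg.
by apply: (local_triangle_free lg eg _ ey); rewrite fC.
Qed.

(** [x''] and a neighbour of [e] in [X1] together see all of [X2] and all full vertices. So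
    [local_union] gives [#|X2| + #|full X1 X2| + 11 <= #|N|], against the bound 8 of
    [rest_isolated_card]. *)
Lemma cover_two_contra X1 X2 e x'' : three_parts X1 X2 ->
  (forall d, d \in rest X1 X2 -> nb d :&: X2 == set0 -> nb d :&: X1 == set0) ->
  e \in full X1 X2 -> x'' \in X1 -> ~~ f e x'' ->
  (forall d, d \in full X1 X2 -> nb d = nb e \/ f d x'') -> False.
Proof.
move=> h nohalf eF x''X nex'' cov; have eE := full_rest eF.
have [x xX ex] := full_nb1 eF; have [y yX ey] := full_nb2 eF.
have neq : x != x'' by apply: contraNneq nex'' => <-.
have nxx : ~~ f x x'' by apply: (parts_indep1 h).
have xN := subsetP (parts_sub1 h) _ xX; have x''N := subsetP (parts_sub1 h) _ x''X.
have U := local_union lg xN x''N neq nxx.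
have sub : X2 :|: full X1 X2 \subset nb x :|: nb x''.
  apply/subsetP => z; rewrite in_setU => /orP[zX|zF]; rewrite !inE.
    have := rest_edge h eE xX ex zX; case: (boolP (f e z)) => ez.
      move=> _; have := rest_edge (three_partsC h) (_ : e \in rest X2 X1) zX ez x''X.
      by rewrite restC fC (negbTE nex'') => /(_ eE)/esym/negbFE ->; rewrite orbT.
    by rewrite fC (negbTE ez) => /esym/negbFE; rewrite fC => ->.
  case: (cov z zF) => [E|]; last by rewrite (fC z) => ->; rewrite orbT.
  have : x \in nb z by rewrite E inE.
  by rewrite inE fC => ->.
have dis : X2 :&: full X1 X2 = set0.
  apply/setP => z; rewrite in_setI in_set0; apply/negP => /andP[zX /full_rest].
  by move/rest_notin2; rewrite zX.
have := subset_leq_card sub; rewrite cardsU dis cards0 subn0.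
have [c1 c2 _] := rest_card h; have := rest_isolated_card h.
set E1 := [set _ in _ | _].
have : #|rest X1 X2| <= #|E1| + #|full X1 X2|.
  apply: leq_trans (leq_card_setU _ _); apply: subset_leq_card.
  apply/subsetP => d dE; rewrite in_setU !(inE, dE) /=.
  case: eqVneq => //= d1; apply/negP => d2; have := nohalf _ dE d2.
  by rewrite (negbTE d1).
move: U c1 c2; clear; lia.
Qed.

(** Counting leaves at most two classes of full vertices with equal neighbourhoods. For two classes
    [cover_two_contra] applies; for one, either that lemma or [full_class_bound] gives the
    contradiction. *)
Lemma no_half_full0 X1 X2 : three_parts X1 X2 ->
  (forall d, d \in rest X1 X2 -> nb d :&: X2 == set0 -> nb d :&: X1 == set0) ->
  full X1 X2 = set0.
Proof.
move=> h nohalf; apply/eqP; apply/set0Pn => -[e eF].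
have eE := full_rest eF.
have [x xX ex] := full_nb1 eF; have [y yX ey] := full_nb2 eF.
have [c1 c2 c3] := rest_card h; have i1 := rest_isolated_card h.
set E1 := [set _ in _ | _] in i1.
have restE : #|rest X1 X2| <= #|E1| + #|full X1 X2|.
  apply: leq_trans (leq_card_setU _ _); apply: subset_leq_card.
  apply/subsetP => d dE; rewrite in_setU !(inE, dE) /=.
  case: eqVneq => //= d1; apply/negP => d2; have := nohalf _ dE d2.
  by rewrite (negbTE d1).
have sb := full_sum_bound h.
have sc : \sum_(B in nb @: full X1 X2) #|B| <= #|X1 :|: X2|.
  have := full_sum_card h (sub0set _); rewrite cards0 addn0; apply=> d _.
  by rewrite disjoints_subset sub0set.
set R := nb @: _ in sb sc.
have X2le : #|X2| <= 8.
  by apply: (local_independent lg (parts_sub2 h)); apply: parts_indep2 h.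
(* For [#|R| = r + 1], [full_sum_bound] and [#|N| <= #|X1 :|: X2| + 8] leave [11 + 3 * r <= 16]. *)
have Rle : #|R| <= 2.
  have : #|R| > 0 by apply/card_gt0P; exists (nb e); apply: imset_f.
  case: #|R| sb => // r; rewrite !mulSn => sb _.
  have : r * #|N| <= r * (#|X1 :|: X2| + 8) by rewrite leq_mul2l c1 leq_add2l c3 orbT.
  rewrite mulnDr; move: sb sc c1 c2 i1 restE X2le; clear; lia.
have [/existsP[e' /andP[e'F ne]]|/existsPn allE] :=
  boolP [exists e', (e' \in full X1 X2) && (nb e' != nb e)].
  have [x'' x''X e'x] := full_nb1 e'F.
  apply: (cover_two_contra h nohalf eF x''X).
    by apply: contra ne => ex''; rewrite (full_nb_eq h e'F eF e'x ex'').
  move=> d dF; case: (eqVneq (nb d) (nb e)) => [|d1]; first by left.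
  case: (eqVneq (nb d) (nb e')) => [E|d2].
    by right; have : x'' \in nb e' by [rewrite inE]; rewrite -E inE.
  have : #|nb d |: [set nb e; nb e']| <= #|R|.
    apply: subset_leq_card; apply/subsetP => B; rewrite !inE => /or3P[] /eqP ->;
      exact: imset_f.
  by rewrite cardsU1 cards2 !inE negb_or d1 d2 eq_sym ne; move: Rle; clear; lia.
have sameE d : d \in full X1 X2 -> nb d = nb e.
  move=> dF; apply/eqP; apply/negPn/negP => nd.
  by move: (allE d); rewrite dF nd.
have [X1e|/subsetPn[x' x'X]] := boolP (X1 \subset nb e); last first.
  rewrite inE => ex'; apply: (cover_two_contra h nohalf eF x'X ex') => d dF.
  by left; apply: sameE.
have Q := full_class_bound h eF.
have {Q} : #|X1 :|: X2| + #|full X1 X2| + 11 <= #|N| + #|nb e|.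
  apply: leq_trans Q; rewrite leq_add2r leq_add2l; apply: subset_leq_card.
  by apply/subsetP => d dF; rewrite inE dF sameE /=.
(* The union is independent: if [d] in [E1] sees [z] in [nb e], then [z] is in [X2], and [x] splits
   [d z], so [e x z] is a triangle. *)
have : #|nb e| + #|E1| <= 8.
  have dis : nb e :&: E1 = set0.
    apply/setP => z; rewrite in_setI in_set0; apply/negP => /andP[ze].
    rewrite inE => /andP[zE _].
    have := subsetP (nb_rest h eE) _ ze.
    by rewrite inE (negbTE (rest_notin1 zE)) (negbTE (rest_notin2 zE)).
  have := cardsU (nb e) E1; rewrite dis cards0 subn0 => <-.
  apply: (local_independent lg).
    rewrite subUset; apply/andP; split.
      by apply/subsetP => z; rewrite inE fC => /(local_dom lg).
    by apply/subsetP => z; rewrite !inE => /andP[/andP[_ ->]].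
  have E1e d z : d \in E1 -> z \in nb e -> ~~ f d z.
    rewrite inE => /andP[dE /eqP d1] ze; apply/negP => dz.
    have nd x0 : x0 \in X1 -> f d x0 = false.
      move=> x0X; apply/negP => dx0.
      by move/setP: d1 => /(_ x0); rewrite !inE dx0 x0X.
    have zX2 : z \in X2.
      have := subsetP (nb_rest h eE) _ ze; rewrite inE => /orP[] // /nd.
      by rewrite dz.
    have := rest_edge (three_partsC h) (_ : d \in rest X2 X1) zX2 dz xX.
    rewrite restC fC (nd _ xX) => /(_ dE)/esym/negbFE xz.
    by move: ze; rewrite inE => /(local_triangle_free lg ex xz).
  move=> a b; rewrite !(in_setU _ (nb e)) => /orP[aX|aE] /orP[bX|bE].
  - move: aX bX; rewrite !inE => ea eb.
    by rewrite (local_no_triangle lg (y := e)) // fC.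
  - by rewrite fC E1e.
  - exact: E1e.
  - by apply: (parts_indep_rest h); [move: aE | move: bE]; rewrite inE => /andP[].
move: c1 c2 restE; clear; lia.
Qed.

(* The [f]-neighbourhoods of full vertices are equal or disjoint, and each of
   them has size at least [#|X1 :|: X2| - #|N| + 11] plus its multiplicity.
   Summing these bounds leaves too little room in [X1 :|: X2]. *)
Lemma three_parts_contra X1 X2 : three_parts X1 X2 -> False.
Proof.
move=> h.
have [F0|/set0Pn[e eF]] := eqVneq (full X1 X2) set0.
  have fullN e x y : e \in rest X1 X2 -> x \in X1 -> y \in X2 -> f e x -> f e y -> False.
    move=> eE xX yX ex ey; have : e \in full X1 X2; last by rewrite F0 inE.
    rewrite inE eE /=; apply/andP; split; apply/set0Pn; [exists x | exists y];
      by rewrite !inE ?ex ?ey.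
  (* Without full vertices each vertex of [rest] has no neighbour in one of the two sets and joins
     that set. *)
  pose c z := (z \in X1) || (z \in rest X1 X2) && (nb z :&: X1 == set0).
  apply: (local_not_bipartite lg (c := c)).
  have key x y : f x y -> c x -> c y -> False.
    have restX u w : u \in X1 -> w \in rest X1 X2 -> nb w :&: X1 == set0 -> f u w -> False.
      move=> uX wE /eqP w1; rewrite fC => wu.
      by move/setP: w1 => /(_ u); rewrite !inE wu uX.
    move=> xy /orP[xX|/andP[xE x1]] /orP[yX|/andP[yE y1]].
    - by move: xy; rewrite (negbTE (parts_indep1 h xX yX)).
    - exact: restX xX yE y1 xy.
    - by apply: restX yX xE x1 _; rewrite fC.
    - by move: xy; rewrite (negbTE (parts_indep_rest h xE yE)).
  have key' x y : f x y -> ~~ c x -> ~~ c y -> False.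
    have notc u w : f u w -> ~~ c u ->
        u \in X2 \/ u \in rest X1 X2 /\ exists2 x0, x0 \in X1 & f u x0.
      move=> uw; rewrite negb_or negb_and => /andP[uX].
      have [uE /= |uE _] := boolP (u \in rest X1 X2).
        move/set0Pn => [x0]; rewrite !inE => /andP[ux0 x0X].
        by right; split=> //; exists x0.
      left; have uN := local_dom lg uw.
      by move: uE; rewrite !inE uN andbT negbK (negbTE uX).
    have X2rest u w : u \in X2 -> w \in rest X1 X2 ->
        (exists2 x0, x0 \in X1 & f w x0) -> f u w -> False.
      by move=> uX wE [x0 x0X wx0]; rewrite fC => wu; apply: (fullN w x0 u).
    move=> xy nx ny; have yx : f y x by rewrite fC.
    case: (notc _ _ xy nx) (notc _ _ yx ny) => [xX|[xE x1]] [yX|[yE y1]].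
    - by move: xy; rewrite (negbTE (parts_indep2 h xX yX)).
    - exact: X2rest xX yE y1 xy.
    - exact: X2rest yX xE x1 yx.
    - by move: xy; rewrite (negbTE (parts_indep_rest h xE yE)).
  move=> x y xy; apply/negP => /eqP E.
  have [cx|cx] := boolP (c x); [apply: (key x y) | apply: (key' x y)] => //.
    by rewrite -E.
  by rewrite -E.
(* By [no_half_full0] in both orders, each side has a vertex of [rest] whose neighbours all lie on
   that side. *)
have half Y1 Y2 : three_parts Y1 Y2 -> e \in full Y1 Y2 ->
    exists2 d, d \in rest Y1 Y2 & (nb d :&: Y2 == set0) && (nb d :&: Y1 != set0).
  move=> hY eY; apply/exists_inP; rewrite -[X in is_true X]negbK.
  apply/negP => /exists_inPn noh.
  have := no_half_full0 hY (_ : forall d, _); move/(_ _)/setP => /(_ _ e).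
  rewrite eY inE => H; suff : true = false by [].
  by apply: H => d dE d2; have := noh d dE; rewrite d2 /= negbK.
have [h1 h1E /andP[h12 /set0Pn[x1]]] := half _ _ h eF.
rewrite !inE => /andP[h1x _].
have h' := three_partsC h.
have eF' : e \in full X2 X1 by rewrite fullC.
have [h2 h2E /andP[h21 /set0Pn[x2]]] := half _ _ h' eF'.
rewrite !inE => /andP[h2x _].
have [b1 s1 d1] := half_nb h h1E h12 h1x.
have [b2 s2 d2] := half_nb h' h2E h21 h2x.
have dis12 : nb h1 :&: nb h2 = set0.
  apply/eqP; rewrite setI_eq0; apply: disjointWl s1 _; apply: disjointWr s2 _.
  exact: parts_disjoint h.
(* These two neighbourhoods take at least six vertices of [X1 :|: X2], which brings the final count
   to [17 <= 16]. *)
have := full_sum_card h (H := nb h1 :|: nb h2).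
rewrite setUSS // => /(_ isT).
have dH d : d \in full X1 X2 -> [disjoint nb h1 :|: nb h2 & nb d].
  move=> dF; rewrite disjoints_subset subUset -!disjoints_subset d1 //= d2 //.
  by rewrite fullC.
move/(_ dH); rewrite [#|_ :|: nb h2|]cardsU dis12 cards0 subn0 => sc.
have sb := full_sum_bound h.
have [c1 c2 c3] := rest_card h; have i1 := rest_isolated_card h.
have i2 := rest_isolated_card h'.
rewrite restC in i2.
have : #|rest X1 X2| <= #|[set e in rest X1 X2 | nb e :&: X1 == set0]|
   + #|[set e in rest X1 X2 | nb e :&: X2 == set0]| + #|full X1 X2|.
  apply: leq_trans (leq_add (leq_card_setU _ _) (leqnn _)).
  apply: leq_trans (leq_card_setU _ _); apply: subset_leq_card.
  apply/subsetP => d dE; rewrite !in_setU !(inE, dE) /=.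
  by case: (nb d :&: X1 == set0); case: (nb d :&: X2 == set0).
set R := nb @: _ in sb sc *.
have : #|R| > 0 by apply/card_gt0P; exists (nb e); apply: imset_f.
case: #|R| sb => // r; rewrite !mulSn => sb _.
have : r * #|N| <= r * (#|X1 :|: X2| + 8) by rewrite leq_mul2l c1 leq_add2l c3 orbT.
rewrite mulnDr; move: sb sc c1 c2 i1 i2 b1 b2; clear; lia.
Qed.

End SplittingSets.

(** * Colourings, cliques and claws *)

(** Colours are plain numbers on all of [G], constrained only on [A], so a colouring of a subgraph
    extends by redefining values without changing types. *)
Definition colored (G : sgraph) (A : {set G}) (k : nat) (c : G -> nat) : Prop :=
  {in A, forall x, c x < k} /\ {in A &, forall x y, edge x y -> c x != c y}.

Definition clique (G : sgraph) (K : {set G}) : Prop :=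
  {in K &, forall x y, x != y -> edge x y}.

Lemma chi_le (G : sgraph) k (c : G -> nat) : colored [set: G] k c -> chi G <= k.
Proof.
case=> lt_c c_proper; rewrite /chi; case: ex_minnP => m _; apply.
apply/existsP; exists [ffun x => Ordinal (lt_c x (in_setT x))].
apply/forallP => x; apply/forallP => y; apply/implyP => xy; rewrite !ffunE.
by rewrite -val_eqE /=; apply: c_proper; rewrite ?in_setT.
Qed.

Lemma chi_remove_colored (G : sgraph) (D : {set G}) :
  exists c : G -> nat, colored (~: D) (chi (remove D)) c.
Proof.
rewrite {1}/chi; case: ex_minnP => m /existsP[c /forallP c_proper] _.
exists (fun x => if insub x is Some y then nat_of_ord (c y) else 0).
split=> [x xD | x y xD yD xy]; first by rewrite insubT ltn_ord.
rewrite !insubT val_eqE; move/forallP: (c_proper (Sub x xD)) => /(_ (Sub y yD)).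
by move/implyP; apply; rewrite /edge /= /induced_rel /= .
Qed.

Lemma claw_free_forbid (G : sgraph) (c x y z : G) : claw_free G ->
  edge c x -> edge c y -> edge c z -> x != y -> x != z -> y != z ->
  ~~ edge x y -> ~~ edge x z -> ~~ edge y z -> False.
Proof.
move=> cf cx cy cz xy xz yz nxy nxz nyz.
have [ncx ncy ncz] : [/\ c != x, c != y & c != z].
  by split; apply/eqP => E; [move: cx | move: cy | move: cz]; rewrite -E edge_irr.
pose S := [set c; x; y; z].
pose g (u : complete_bipartite 1 3) : G :=
  match u with inl _ => c | inr i => nth c [:: x; y; z] i end.
have gS u : g u \in S.
  by rewrite !inE; case: u => [i|[[|[|[]]] //= _]]; rewrite /= eqxx ?orbT.
pose h u : induced S := Sub (g u) (gS u).
have g_inj : injective g.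
  move=> [i|i] [j|j] /=.
  - by rewrite !ord1.
  - by case: j => -[|[|[]]] //= lt /eqP; rewrite ?(negbTE ncx) ?(negbTE ncy) ?(negbTE ncz).
  - by case: i => -[|[|[]]] //= lt /eqP; rewrite eq_sym ?(negbTE ncx) ?(negbTE ncy) ?(negbTE ncz).
  - move=> E; congr inr; apply/val_inj => /=; apply/eqP.
    rewrite -(nth_uniq c (s := [:: x; y; z])) ?E //=; last by rewrite !inE negb_or xy xz yz.
have h_inj : injective h by move=> u w /(congr1 val) /= /g_inj.
have h_surj w : exists u, h u = w.
  have : val w \in S by apply: valP.
  rewrite !inE => /orP[/orP[/orP[]|]|] /eqP E.
  - by exists (inl ord0); apply/val_inj.
  - by exists (inr (inord 0)); apply/val_inj; rewrite /= inordK.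
  - by exists (inr (inord 1)); apply/val_inj; rewrite /= inordK.
  - by exists (inr (inord 2)); apply/val_inj; rewrite /= inordK.
have card : #|complete_bipartite 1 3| = #|induced S|.
  rewrite -(card_codom h_inj); apply: eq_card => w; rewrite [RHS]inE.
  by apply/codomP; have [u <-] := h_surj w; exists u.
have [h' hK h'K] := inj_card_bij h_inj (eq_leq (esym card)).
apply: (cf S); exists h'; split; first by exists h.
move=> u w; rewrite -{2}(h'K u) -{2}(h'K w); move: (h' u) (h' w) => {}u {}w.
rewrite /edge /= /induced_rel /=.
case: u => [i|[[|[|[]]] //= ?]]; case: w => [j|[[|[|[]]] //= ?]];
  by rewrite /= ?edge_irr ?cx ?cy ?cz // 1?edge_sym ?cx ?cy ?cz ?(negbTE nxy) ?(negbTE nxz) ?(negbTE nyz)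
     // edge_sym ?(negbTE nxy) ?(negbTE nxz) ?(negbTE nyz).
Qed.

Lemma clique_chi (G : sgraph) (K : {set G}) (A : {set G}) k c :
  clique K -> K \subset A -> colored A k c -> #|K| <= k.
Proof.
move=> cK KA [lt_c c_proper].
have c_inj : {in K &, injective c}.
  move=> x y xK yK E; apply/eqP/negPn/negP => xy.
  have := c_proper _ _ (subsetP KA _ xK) (subsetP KA _ yK) (cK _ _ xK yK xy).
  by rewrite E eqxx.
rewrite cardE -(size_map c) -(size_iota 0 k); apply: uniq_leq_size.
  by rewrite map_inj_in_uniq ?enum_uniq // => x y; rewrite !mem_enum; apply: c_inj.
move=> i /mapP[x]; rewrite mem_enum mem_iota => /(subsetP KA)/lt_c lt ->.
exact: lt.
Qed.

Lemma colors_card (G : sgraph) (A : {set G}) (c : G -> nat) k :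
  (forall i, i < k -> exists2 x, x \in A & c x = i) -> k <= #|A|.
Proof.
move=> h; rewrite cardE -(size_map c) -(size_iota 0 k).
apply: uniq_leq_size (iota_uniq _ _) _ => i; rewrite mem_iota => /h[x xA <-].
by apply/mapP; exists x; rewrite ?mem_enum.
Qed.

(** * Neighbourhoods in the critical graph *)

(** The consequences of the hypotheses used below, joined with the absence of a clique on 12
    vertices; the goal is to refute this record. *)
Record tricritical (G : sgraph) : Prop := Tricritical {
  tri_claw : claw_free G;
  tri_chi : forall c : G -> nat, ~ colored [set: G] 11 c;
  tri_vertex : forall v : G, exists c, colored (~: [set v]) 11 c;
  tri_triangle : forall a b c : G, edge a b -> edge a c -> edge b c ->
    exists col, colored (~: [set a; b; c]) 9 col;
  tri_clique : forall K : {set G}, clique K -> #|K| < 12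
}.

Definition nbh (G : sgraph) (v : G) : {set G} := [set x | edge v x].
Definition nonadj (G : sgraph) (v : G) : rel G :=
  fun x y => [&& edge v x, edge v y, x != y & ~~ edge x y].

Section Tricritical.
Variable G : sgraph.
Hypothesis tc : tricritical G.
Implicit Types (a b u v w x y z : G).

Lemma edge_neq x y : edge x y -> x != y.
Proof. by apply: contraTneq => ->; rewrite edge_irr. Qed.

Lemma no_claw v x y z : edge v x -> edge v y -> edge v z ->
  x != y -> x != z -> y != z -> ~~ edge x y -> ~~ edge x z -> edge y z.
Proof.
move=> vx vy vz xy xz yz nxy nxz; apply/negPn/negP => nyz.
exact: (claw_free_forbid (tri_claw tc) vx vy vz).
Qed.

(** A colour of [G - v] absent from the neighbours of [v] could be given to [v]. *)
Lemma degree_ge v : 11 <= #|nbh v|.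
Proof.
have [c [lt_c c_proper]] := tri_vertex tc v.
apply: (colors_card (c := c)) => i lt_i.
case: (boolP [exists x in nbh v, c x == i]) => [/exists_inP[x xN /eqP]|/exists_inPn noi].
  by exists x.
have out x : x != v -> x \in ~: [set v] by rewrite !inE.
case: (tri_chi tc (c := fun x => if x == v then i else c x)); split=> [x _|x y _ _ xy].
  by case: eqVneq => // /out/lt_c.
case: (eqVneq x v) => [xv|xv]; case: (eqVneq y v) => [yv|yv].
- by move: xy; rewrite xv yv edge_irr.
- by rewrite eq_sym; apply: noi; rewrite inE -xv.
- by apply: noi; rewrite inE -yv edge_sym.
- by apply: c_proper; rewrite ?out.
Qed.

(* Otherwise the class [i] and the triangle could be recoloured with three
   colours, giving an 11-colouring of [G]. *)
Lemma class_full v a b col i : edge v a -> edge v b -> edge a b ->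
  colored (~: [set v; a; b]) 9 col -> i < 9 ->
  exists z, [/\ edge v z, edge a z, edge b z & col z = i].
Proof.
move=> va vb ab [lt_c c_proper] lt_i.
case: (boolP [exists z, [&& edge v z, edge a z, edge b z & col z == i]]).
  by case/existsP => z /and4P[? ? ? /eqP]; exists z.
move=> /existsPn nofull; exfalso.
have nva := edge_neq va; have nvb := edge_neq vb; have nab := edge_neq ab.
(* The triangle gets [i], 9 and 10, and each vertex of class [i] takes the colour of a triangle
   vertex that it misses; [nofull] makes the last case safe. *)
pose col' x := if x == v then i else if x == a then 9 else if x == b then 10 else
  if col x == i then (if ~~ edge v x then i else if ~~ edge a x then 9 else 10)
  else col x.
have out x : x != v -> x != a -> x != b -> x \in ~: [set v; a; b].
  by rewrite !inE !negb_or => -> -> ->.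
have lt_out x : x != v -> x != a -> x != b -> col x < 9.
  by move=> xv xa xb; apply/lt_c/out.
have proper x y : edge x y -> x \in [set v; a; b] -> col' x != col' y.
  move=> xy xT.
  have cxE : (x = v /\ col' x = i) \/ (x = a /\ col' x = 9) \/ (x = b /\ col' x = 10).
    move: xT; rewrite !inE /col' => /orP[/orP[]|] /eqP ->; rewrite eqxx.
    - by left.
    - by rewrite eq_sym (negbTE nva); right; left.
    - by rewrite eq_sym (negbTE nvb) eq_sym (negbTE nab); right; right.
  have [yT|yT] := boolP (y \in [set v; a; b]).
    have cyE : (y = v /\ col' y = i) \/ (y = a /\ col' y = 9) \/ (y = b /\ col' y = 10).
      move: yT; rewrite !inE /col' => /orP[/orP[]|] /eqP ->; rewrite eqxx.
      - by left.
      - by rewrite eq_sym (negbTE nva); right; left.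
      - by rewrite eq_sym (negbTE nvb) eq_sym (negbTE nab); right; right.
    have nxy := edge_neq xy.
    by case: cxE cyE => [[Ex ->]|[[Ex ->]|[Ex ->]]] [[Ey ->]|[[Ey ->]|[Ey ->]]];
      rewrite ?Ex ?Ey ?eqxx // in nxy *; move: lt_i; clear; lia.
  move: (yT); rewrite !inE !negb_or => /andP[/andP[yv ya] yb].
  have lty := lt_out _ yv ya yb.
  have := nofull y; rewrite /col' (negbTE yv) (negbTE ya) (negbTE yb) -/(col' x).
  case: (eqVneq (col y) i) => [yi|yi]; last first.
    by case: cxE => [[_ ->]|[[_ ->]|[_ ->]]] _; rewrite 1?eq_sym //;
       move: lty; clear; lia.
  rewrite andbT; case: cxE => [[Ex ->]|[[Ex ->]|[Ex ->]]]; rewrite Ex in xy;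
    move: xy lt_i; case: (edge v y); case: (edge a y); case: (edge b y) => //= _;
    clear; lia.
case: (tri_chi tc (c := col')); split=> [x _|x y _ _ xy].
  rewrite /col'; case: eqP => [_|/eqP xv]; first by move: lt_i; clear; lia.
  case: eqP => [//|/eqP xa]; case: eqP => [//|/eqP xb].
  have := lt_out _ xv xa xb; do 3?[case: ifP => _]; move: lt_i; clear; lia.
have [xT|xT] := boolP (x \in [set v; a; b]); first exact: proper.
have [yT|yT] := boolP (y \in [set v; a; b]).
  by rewrite eq_sym; apply: proper; rewrite // edge_sym.
have cxy : col x != col y by apply: c_proper; rewrite // inE.
move: (xT) (yT); rewrite !inE !negb_or => /andP[/andP[xv xa] xb] /andP[/andP[yv ya] yb].
have := lt_out _ xv xa xb; have := lt_out _ yv ya yb.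
rewrite /col' (negbTE yv) (negbTE ya) (negbTE yb) (negbTE xv) (negbTE xa) (negbTE xb).
move: cxy lt_i; case: (eqVneq (col x) i) => [->|nx]; case: (eqVneq (col y) i) => [->|ny];
  try (move: nx); try (move: ny); clear; do 4?[case: ifP => _]; lia.
Qed.

(** The colour class of [x] off the triangle contains a vertex complete to the triangle. It differs
    from [x], and sharing its colour is not adjacent to it. *)
Lemma class_full_nonadj v a b x : edge v a -> edge v b -> edge a b ->
  edge v x -> ~~ edge a x || ~~ edge b x -> x != a -> x != b ->
  exists z, [/\ edge v z, edge a z, edge b z & nonadj v x z].
Proof.
move=> va vb ab vx nx xa xb; have [col hc] := tri_triangle tc va vb ab.
have xT : x \in ~: [set v; a; b].
  by rewrite !inE !negb_or xa xb eq_sym edge_neq.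
have [z [vz az bz Ez]] := class_full va vb ab hc (hc.1 _ xT).
exists z; split=> //.
have xz : x != z by apply: contraTneq nx => ->; rewrite az bz.
rewrite /nonadj vx vz xz /=; apply/negP => ez.
have zT : z \in ~: [set v; a; b].
  by rewrite !inE !negb_or ![z == _]eq_sym !edge_neq.
by have := hc.2 _ _ xT zT ez; rewrite Ez eqxx.
Qed.

Lemma common_nbh_ge v a b : edge v a -> edge v b -> edge a b ->
  9 <= #|nbh v :&: nbh a :&: nbh b|.
Proof.
move=> va vb ab; have [col hc] := tri_triangle tc va vb ab.
apply: (colors_card (c := col)) => i lt_i.
have [z [vz az bz Ez]] := class_full va vb ab hc lt_i.
by exists z; rewrite // !inE vz az bz.
Qed.

(* A neighbour in no triangle with [v] would make the other neighbours of [v]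
   a clique, of size at least 11. *)
Lemma edge_in_triangle v w : edge v w -> exists z, edge v z && edge w z.
Proof.
move=> vw; apply/existsP; case: (boolP [exists z, _]) => // /existsPn notri; exfalso.
have nw z : edge v z -> ~~ edge w z by move=> vz; have := notri z; rewrite vz.
pose A := nbh v :\ w.
have cA : clique (v |: A).
  move=> x y; rewrite !inE => /orP[/eqP ->|/andP[xw vx]] /orP[/eqP ->|/andP[yw vy]].
  - by rewrite eqxx.
  - by [].
  - by rewrite edge_sym.
  - by move=> xy; apply: (no_claw vw vx vy _ _ xy (nw _ vx) (nw _ vy)); rewrite eq_sym.
have cardA : #|v |: A| = (#|A|).+1 by rewrite cardsU1 !inE edge_irr andbF.
have cardN : #|nbh v| = (#|A|).+1 by rewrite (cardsD1 w) inE vw.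
have : 1 < #|A| by have := degree_ge v; rewrite cardN => /ltnSE; apply: leq_trans.
case/card_gt1P => a [b [aA bA ab]].
have [aw va] : a != w /\ edge v a by move: aA; rewrite !inE => /andP[].
have [bw vb] : b != w /\ edge v b by move: bA; rewrite !inE => /andP[].
have eab : edge a b by apply: cA; rewrite ?inE ?aw ?va ?bw ?vb ?orbT.
have := common_nbh_ge va vb eab; have := tri_clique tc cA; rewrite cardA.
(* As [w] is excluded, at most [#|A| - 2 <= 8] common neighbours remain, against the 9 of
   [common_nbh_ge]. *)
have sub : nbh v :&: nbh a :&: nbh b \subset A :\ a :\ b.
  apply/subsetP => z; rewrite !inE => /andP[/andP[vz az] bz].
  rewrite vz andbT ![z == _]eq_sym (edge_neq az) (edge_neq bz) /=.
  by apply: contraTneq az => <-; rewrite edge_sym nw.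
have bAa : b \in A :\ a by rewrite !inE eq_sym ab bw vb.
have := subset_leq_card sub; have := cardsD1 a A; have := cardsD1 b (A :\ a).
by rewrite aA bAa; clear; lia.
Qed.

Lemma nonadj_sym v : symmetric (nonadj v).
Proof. by move=> x y; rewrite /nonadj andbCA (eq_sym x) [edge x y]edge_sym. Qed.

Lemma nonadj_triangle_free v x y z :
  nonadj v x y -> nonadj v y z -> nonadj v x z -> False.
Proof.
move=> /and4P[vx vy xy nxy] /and4P[_ vz yz nyz] /and4P[_ _ xz nxz].
by have := no_claw vx vy vz xy xz yz nxy nxz; rewrite (negbTE nyz).
Qed.

Lemma nonadjN v x y : edge v x -> edge v y -> x != y -> ~~ nonadj v x y -> edge x y.
Proof. by rewrite /nonadj => -> -> -> /negPn. Qed.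

(** A triangle [v y b] yields a non-neighbour [z] of [x], and the triangle [v y z] yields [z2].
    Being pairwise adjacent, [y], [z], [z2] are distinct. *)
Lemma nonadj_degree v x y : nonadj v x y -> 3 <= #|nb (nonadj v) x|.
Proof.
move=> xa; have /and4P[vx va nxa exa] := xa.
have [b /andP[vb ab]] := edge_in_triangle va.
have eax : ~~ edge y x by rewrite edge_sym.
have xb : x != b by apply: contraTneq ab => <-.
have [z [vz az _ xz]] := class_full_nonadj va vb ab vx (introT orP (or_introl eax)) nxa xb.
have /and4P[_ _ nxz _] := xz.
have [z2 [vz2 az2 zz2 xz2]] :=
  class_full_nonadj va vz az vx (introT orP (or_introl eax)) nxa nxz.
have <- : #|y |: [set z; z2]| = 3.
  by rewrite cardsU1 cards2 !inE negb_or (edge_neq az) (edge_neq az2) (edge_neq zz2).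
apply: subset_leq_card; apply/subsetP => t.
by rewrite !inE => /or3P[] /eqP ->.
Qed.

(** The 11 comes from nine vertices complete to the triangle [v a b], together with [a] and [b]. *)
Lemma nonadj_union v a b : edge v a -> edge v b -> edge a b ->
  #|nb (nonadj v) a :|: nb (nonadj v) b| + 11 <= #|nbh v|.
Proof.
move=> va vb ab; set U := _ :|: _; pose C := nbh v :&: nbh a :&: nbh b.
have dUC : U :&: C = set0.
  apply/setP => z; rewrite !inE; apply/negP => /andP[] /orP[] /and4P[_ _ _];
    by move=> /negbTE ->; rewrite ?andbF.
have dUCab : (U :|: C) :&: [set a; b] = set0.
  have ba : edge b a by rewrite edge_sym.
  apply/setP => z; rewrite !inE; apply/negP => /andP[+ /orP[]] /eqP E; rewrite E;
    by rewrite /nonadj !eqxx ?edge_irr ?ab ?ba ?andbF.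
have sub : U :|: C :|: [set a; b] \subset nbh v.
  apply/subsetP => z; rewrite !inE => /orP[/orP[/orP[]|]|/orP[]].
  - by case/and4P.
  - by case/and4P.
  - by case/andP => /andP[].
  - by move/eqP->.
  - by move/eqP->.
have := subset_leq_card sub; rewrite cardsU dUCab cards0 subn0 cardsU dUC cards0 subn0.
by have := common_nbh_ge va vb ab; rewrite cards2 edge_neq // -/C; clear; lia.
Qed.

Lemma nonadj_double_union v a b x y : nonadj v a x -> nonadj v b y -> edge a b ->
  #|nb (nonadj v) a :|: nb (nonadj v) b|.*2 + 2 <= #|nonisolated (nonadj v)|.
Proof.
move=> ax bY ab; have /and4P[va _ _ _] := ax; have /and4P[vb _ _ _] := bY.
set U := _ :|: _; pose C := nbh v :&: nbh a :&: nbh b.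
have [col hc] := tri_triangle tc va vb ab.
have ba : edge b a by rewrite edge_sym.
have UP u : u \in U -> [/\ edge v u, u \in ~: [set v; a; b] & u \notin C].
  move=> uU.
  have [vu au bu nab] : [/\ edge v u, a != u, b != u & ~~ (edge a u && edge b u)].
    case/setUP: uU; rewrite inE => /and4P[_ vu nu eu]; split=> //.
    - by apply: contraNneq eu => <-.
    - by rewrite (negbTE eu).
    - by apply: contraNneq eu => <-.
    - by rewrite (negbTE eu) andbF.
  split=> //; first by rewrite !inE !negb_or ![u == _]eq_sym (edge_neq vu) au bu.
  by rewrite !inE vu.
have CP z : z \in C -> edge v z /\ z \in ~: [set v; a; b].
  rewrite !inE !negb_or ![z == _]eq_sym => /andP[/andP[vz az] bz].
  by rewrite !edge_neq.
pose g u := odflt u [pick z in C | col z == col u].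
have gP u : u \in U -> g u \in C /\ col (g u) = col u.
  move=> uU; rewrite /g; case: pickP => [z /andP[zC /eqP]|no] //=.
  have [vu uT _] := UP u uU.
  have [z [vz az bz Ez]] := class_full va vb ab hc (hc.1 _ uT).
  by have := no z; rewrite Ez eqxx andbT !inE vz az bz.
have same u w : edge v u -> edge v w -> u \in ~: [set v; a; b] ->
    w \in ~: [set v; a; b] -> u != w -> col u = col w -> nonadj v u w.
  move=> vu vw uT wT uw E; rewrite /nonadj vu vw uw /=; apply/negP => /(hc.2 _ _ uT wT).
  by rewrite E eqxx.
have gU u : u \in U -> nonadj v u (g u).
  move=> uU; have [vu uT uC] := UP u uU; have [gC gE] := gP u uU.
  by have [vg gT] := CP _ gC; apply: same => //; apply: contraNneq uC => ->.
have g_inj : {in U &, injective g}.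
  move=> u w uU wU E; apply/eqP/negPn/negP => uw.
  have [vu uT _] := UP u uU; have [vw wT _] := UP w wU.
  have uwE : col u = col w by rewrite -(gP u uU).2 E (gP w wU).2.
  have := gU w wU; rewrite -E nonadj_sym => gw.
  apply: (nonadj_triangle_free (gU u uU) gw); exact: same.
have cardg : #|g @: U| = #|U| by apply: card_in_imset.
have dUg : U :&: (g @: U) = set0.
  apply/setP => z; rewrite in_setI in_set0; apply/negP => /andP[zU /imsetP[u uU E]].
  by have [_ _] := UP z zU; rewrite E (gP u uU).1.
have dab : (U :|: g @: U) :&: [set a; b] = set0.
  apply/setP => z; rewrite in_setI in_set0 in_setU; apply/negP => /andP[zUg zab].
  have : z \in ~: [set v; a; b].
    case/orP: zUg => [/UP[] //|/imsetP[u uU ->]].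
    by have [gC _] := gP u uU; have [] := CP _ gC.
  by move: zab; rewrite !inE => /orP[] ->; rewrite ?orbT.
have sub : U :|: g @: U :|: [set a; b] \subset nonisolated (nonadj v).
  apply/subsetP => z /setUP[/setUP[zU|/imsetP[u uU ->]]|].
  - by apply/nonisolatedP; exists (g z); apply: gU.
  - by apply/nonisolatedP; exists u; rewrite nonadj_sym; apply: gU.
  - by rewrite !inE -/(nb _ _) => /orP[] /eqP ->; apply/set0Pn; [exists x | exists y]; rewrite inE.
have := subset_leq_card sub.
rewrite cardsU dab cards0 subn0 cardsU dUg cards0 subn0 cardg cards2 edge_neq //.
by clear; lia.
Qed.

(** A clique of size 10 meets every triangle [T], as [G - T] is 9-colourable. So a vertex [v]
    outside [K] has at most two neighbours outside [K], by claw-freeness, and at most 13 in all. If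
    [N(v)] were not a clique, [nonadj_union] would force 14; if it is one, adding [v] gives a clique
    of size 12. *)
Lemma clique_le (K : {set G}) : clique K -> #|K| <= 9.
Proof.
move=> cK; rewrite leqNgt; apply/negP => ltK.
have notri a b c : edge a b -> edge a c -> edge b c ->
    a \notin K -> b \notin K -> c \notin K -> False.
  move=> ab ac bc aK bK cK'; have [col hc] := tri_triangle tc ab ac bc.
  have := clique_chi cK _ hc; rewrite leqNgt ltK => /(_ _)/notF; apply.
  apply/subsetP => z zK; rewrite !inE !negb_or.
  by apply/andP; split; [apply/andP; split|]; apply: contraTneq zK => ->.
have [v vK] : exists v, v \notin K.
  apply/existsP; case: (boolP [exists x, _]) => // /existsPn KT; exfalso.
  have KE : K = [set: G] by apply/setP => z; rewrite !inE; apply/negPn/KT.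
  pose c (x : G) := nat_of_ord (enum_rank x).
  apply: (tri_chi tc (c := c)); split=> [x _|x y _ _ xy].
    have := tri_clique tc cK; rewrite KE cardsT => lt12.
    by apply: leq_trans (ltn_ord _) _.
  by rewrite /c val_eqE (inj_eq enum_rank_inj) edge_neq.
have cN : clique (nbh v).
  move=> x y xN yN xy; apply/negPn/negP => nxy.
  have xy' : nonadj v x y by rewrite !inE in xN yN; rewrite /nonadj xN yN xy.
  have : 1 < #|nb (nonadj v) x| by apply: leq_trans (nonadj_degree xy').
  case/card_gt1P => a [b []]; rewrite !inE => xa xb ab.
  have /and4P[_ va _ _] := xa; have /and4P[_ vb _ _] := xb.
  have eab : edge a b.
    apply: (nonadjN va vb ab); apply/negP => eab.
    by apply: (nonadj_triangle_free xa eab xb).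
  have := nonadj_union va vb eab.
  have : 3 <= #|nb (nonadj v) a :|: nb (nonadj v) b|.
    apply: leq_trans (subset_leq_card (subsetUl _ _)).
    by apply: (@nonadj_degree v a x); rewrite nonadj_sym.
  have : #|nbh v| <= 2 + 11.
    rewrite -(cardsID K) addnC; apply: leq_add; last first.
      have := tri_clique tc cK => /ltnSE; apply: leq_trans.
      by apply: subset_leq_card; apply: subsetIr.
    rewrite leqNgt; apply/negP => /card_gt2P[p [q [r [[pN qN rN] [pq qr rp]]]]].
    move: pN qN rN; rewrite !inE => /andP[pK vp] /andP[qK vq] /andP[rK vr].
    have npq : ~~ edge p q by apply/negP => e; apply: (notri v p q).
    have nqr : ~~ edge q r by apply/negP => e; apply: (notri v q r).
    have npr : ~~ edge p r by apply/negP => e; apply: (notri v p r).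
    have pr : p != r by rewrite eq_sym.
    by have := no_claw vp vq vr pq pr qr npq npr; rewrite (negbTE nqr).
  by clear; lia.
have cV : clique (v |: nbh v).
  move=> x y; rewrite !inE => /orP[/eqP ->|vx] /orP[/eqP ->|vy] xy.
  - by rewrite eqxx in xy.
  - by [].
  - by rewrite edge_sym.
  - by apply: cN; rewrite ?inE.
by have := tri_clique tc cV; rewrite cardsU1 !inE edge_irr /=; have := degree_ge v; clear; lia.
Qed.

Lemma local_graph_nonadj v : local_graph (nonadj v) (nbh v).
Proof.
split.
- exact: nonadj_sym.
- by move=> x y /and4P[vx _ _ _]; rewrite inE.
- exact: nonadj_triangle_free.
- exact: nonadj_degree.
- move=> a b; rewrite !inE => va vb ab nab; apply: nonadj_union => //.
  exact: nonadjN va vb ab nab.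
- move=> a b x y ax bY ab nab; apply: (nonadj_double_union ax bY).
  have /and4P[va _ _ _] := ax; have /and4P[vb _ _ _] := bY.
  exact: nonadjN va vb ab nab.
(* Adding [v] to [I] gives a clique, so the 9 of [clique_le] drops to 8. *)
- move=> I IN iI; have vI : v \notin I.
    by apply/negP => /(subsetP IN); rewrite inE edge_irr.
  have : clique (v |: I).
    move=> x y; rewrite !inE => /orP[/eqP ->|xI] /orP[/eqP ->|yI] xy.
    + by rewrite eqxx in xy.
    + by have := subsetP IN _ yI; rewrite inE.
    + by have := subsetP IN _ xI; rewrite inE edge_sym.
    + have := subsetP IN _ yI; have := subsetP IN _ xI; rewrite !inE => vx vy.
      by apply: (nonadjN vx vy xy); apply: iI.
  by move/clique_le; rewrite cardsU1 vI.
- exact: degree_ge.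
Qed.

End Tricritical.

(** * Stability number two *)

(* A pairing encodes a colouring with classes of size at most two: the classes
   are the sets [{x, m x}]. *)
Section Pairing.
Variable G : sgraph.
Implicit Types (m : {ffun G -> G}) (x y z : G).

Definition pairing m := [forall x, (m (m x) == x) && ~~ edge x (m x)].
Definition fixed m : {set G} := [set x | m x == x].
(** One representative per class [{x, m x}], so its cardinality is the number of colours. *)
Definition lows m : {set G} := [set x | enum_rank x <= enum_rank (m x)].

Lemma pairingP m : reflect ((forall x, m (m x) = x) /\ forall x, ~~ edge x (m x)) (pairing m).
Proof.
apply: (iffP forallP) => [h|[h1 h2] x]; last by rewrite h1 h2 eqxx.
by split=> x; have /andP[/eqP] := h x.
Qed.

Lemma lows_card m : pairing m -> #|lows m|.*2 = #|G| + #|fixed m|.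
Proof.
case/pairingP => mK _; pose L := [set x | enum_rank x < enum_rank (m x)].
have m_inj : injective m by apply: can_inj mK.
have -> : #|lows m| = #|fixed m| + #|L|.
  rewrite -(cardsID (fixed m) (lows m)); congr (_ + _); apply: eq_card => x; rewrite !inE.
    by case: eqP => [->|]; rewrite ?leqnn ?andbF.
  rewrite [RHS]ltn_neqAle; congr (_ && _).
  by rewrite val_eqE (inj_eq enum_rank_inj) eq_sym.
have -> : #|G| = #|fixed m| + #|L| + #|m @: L|.
  rewrite -cardsT -(cardsID (lows m) setT) setTI; congr (_ + _).
    rewrite -(cardsID (fixed m) (lows m)); congr (_ + _); apply: eq_card => x; rewrite !inE.
      by case: eqP => [->|]; rewrite ?leqnn ?andbF.
    rewrite [RHS]ltn_neqAle; congr (_ && _).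
    by rewrite val_eqE (inj_eq enum_rank_inj) eq_sym.
  apply: eq_card => x; rewrite !inE andbT -ltnNge; apply/idP/imsetP => [lt|[y + ->]].
    by exists (m x); rewrite ?inE mK.
  by rewrite inE mK.
by rewrite card_imset //; clear; lia.
Qed.

(** Fewer than 12 classes would give an 11-colouring, by the index of the class representative.
    Pairings attaining 24 are the optimal ones. *)
Lemma pairing_card m : tricritical G -> pairing m -> 24 <= #|G| + #|fixed m|.
Proof.
move=> tc pm; rewrite -lows_card // -[24]/(12.*2) leq_double.
have /pairingP[mK mN] := pm.
rewrite leqNgt; apply/negP => lt12.
pose r x := if enum_rank x <= enum_rank (m x) then x else m x.
have rL x : r x \in lows m.
  rewrite inE /r; case: (leqP (enum_rank x) (enum_rank (m x))) => // lt.
  by rewrite mK ltnW.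
apply: (tri_chi tc (c := fun x => index (r x) (enum (lows m)))); split=> [x _|x y _ _ xy].
  have : index (r x) (enum (lows m)) < size (enum (lows m)) by rewrite index_mem mem_enum.
  by rewrite -cardE => lt; apply: leq_trans lt _.
apply/negP => /eqP E.
have {E} : r x = r y.
  by rewrite -(nth_index x (s := enum (lows m)) (x := r x)) ?mem_enum // E nth_index ?mem_enum.
rewrite /r; case: ifP => _; case: ifP => _ E.
- by move: xy; rewrite E edge_irr.
- by move: (mN y); rewrite -E edge_sym xy.
- by move: (mN x); rewrite E xy.
- by move: xy; rewrite (can_inj mK E) edge_irr.
Qed.

(** Without stable triples a colour class has at most two vertices, and [m] exchanges them; vertices
    of [D] become singletons. *)
Lemma pairing_of_coloring (D : {set G}) k c :
  (forall x y z, x != y -> x != z -> y != z -> ~~ edge x y -> ~~ edge x z -> edge y z) ->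
  colored (~: D) k c ->
  exists2 m, pairing m & D \subset fixed m /\ #|G| + #|fixed m| <= (k + #|D|).*2.
Proof.
move=> a2 [lt_c c_proper].
pose p x y := [&& y \notin D, y != x & c y == c x].
pose m := [ffun x => if x \in D then x else odflt x [pick y | p x y]].
have mD x : x \in D -> m x = x by move=> xD; rewrite ffunE xD.
have same x y : x \notin D -> y \notin D -> c x = c y -> ~~ edge x y.
  move=> xD yD E; apply/negP => xy.
  by have := c_proper x y; rewrite !inE E eqxx => /(_ xD yD xy).
have mP x : x \notin D -> [/\ m x \notin D, c (m x) = c x &
    forall y, y \notin D -> c y = c x -> y = x \/ y = m x].
  move=> xD; rewrite ffunE (negbTE xD); case: pickP => [y /and3P[yD yx /eqP cy]|no] /=; split=> //.
    move=> z zD cz; case: (eqVneq z x) => [|zx]; first by left.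
    case: (eqVneq z y) => [|zy]; first by right.
    have := a2 x y z; rewrite (eq_sym x) yx (eq_sym x) zx (eq_sym y) zy !same ?cy ?cz //.
    move=> /(_ isT isT isT isT isT).
    by rewrite (negbTE (same _ _ yD zD _)) // cy cz.
  move=> z zD cz; case: (eqVneq z x) => [|zx]; first by left.
  by have := no z; rewrite /p zD zx cz eqxx.
have mK x : m (m x) = x.
  have [xD|xD] := boolP (x \in D); first by rewrite !mD.
  have [mxD cmx _] := mP x xD; have [_ _ uniq] := mP _ mxD.
  case: (uniq x xD (esym cmx)) => E; last exact: esym.
  by rewrite -E -E.
have pm : pairing m.
  apply/pairingP; split=> // x.
  have [xD|xD] := boolP (x \in D); first by rewrite mD // edge_irr.
  by have [mxD cmx _] := mP x xD; apply: same.
exists m => //; split; first by apply/subsetP => x xD; rewrite inE mD.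
rewrite -lows_card // leq_double -(cardsID D (lows m)) addnC leq_add //; last first.
  by apply: subset_leq_card; apply: subsetIr.
have c_inj : {in lows m :\: D &, injective c}.
  move=> x y; rewrite !inE => /andP[xD xl] /andP[yD yl] E.
  have [_ _ ux] := mP x xD.
  case: (ux y yD (esym E)) => // E'; subst y.
  rewrite mK in yl; apply/enum_rank_inj/val_inj/eqP.
  by rewrite eqn_leq xl yl.
rewrite cardE -(size_map c) -(size_iota 0 k); apply: uniq_leq_size.
  by rewrite map_inj_in_uniq ?enum_uniq // => x y; rewrite !mem_enum; apply: c_inj.
move=> i /mapP[x]; rewrite mem_enum !inE mem_iota => /andP[xD _] ->.
by apply: lt_c; rewrite inE.
Qed.

Lemma optimal_fixed_edge m x y : tricritical G -> pairing m -> #|G| + #|fixed m| <= 24 ->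
  m x = x -> m y = y -> x != y -> edge x y.
Proof.
move=> tc pm opt mx my xy; apply/negPn/negP => nxy.
have /pairingP[mK mN] := pm.
pose m' := [ffun z => if z == x then y else if z == y then x else m z].
have m'z z : z != x -> z != y -> m' z = m z.
  by move=> zx zy; rewrite ffunE (negbTE zx) (negbTE zy).
have m'x : m' x = y by rewrite ffunE eqxx.
have m'y : m' y = x by rewrite ffunE eq_sym (negbTE xy) eqxx.
have pm' : pairing m'.
  apply/pairingP; split=> z.
    case: (eqVneq z x) => [->|zx]; first by rewrite m'x m'y.
    case: (eqVneq z y) => [->|zy]; first by rewrite m'y m'x.
    rewrite (m'z z) // m'z ?mK //.
      by apply: contraNneq zx => E; rewrite -[z]mK E mx.
    by apply: contraNneq zy => E; rewrite -[z]mK E my.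
  case: (eqVneq z x) => [->|zx]; first by rewrite m'x.
  case: (eqVneq z y) => [->|zy]; first by rewrite m'y edge_sym.
  by rewrite m'z.
have := pairing_card tc pm'.
have : fixed m' \subset fixed m :\ x :\ y.
  apply/subsetP => z; rewrite !inE; case: (eqVneq z y) => [->|zy].
    by rewrite m'y (negbTE xy).
  case: (eqVneq z x) => [->|zx]; first by rewrite m'x eq_sym (negbTE xy).
  by rewrite m'z.
have yF : y \in fixed m :\ x by rewrite !inE eq_sym xy my eqxx.
have xF : x \in fixed m by rewrite inE mx eqxx.
move/subset_leq_card; have := cardsD1 x (fixed m); have := cardsD1 y (fixed m :\ x).
by rewrite xF yF; move: opt; clear; lia.
Qed.

(* Gallai's lemma at distance two: no optimal pairing misses both neighbours
   [u], [v] of [t] in the complement when another one misses [t]. *)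
Lemma pairing_exchange m m0 t u v : tricritical G ->
  pairing m -> #|G| + #|fixed m| <= 24 -> m u = u -> m v = v -> u != v ->
  pairing m0 -> #|G| + #|fixed m0| <= 24 -> m0 t = t ->
  ~~ edge t u -> ~~ edge t v -> t != u -> t != v -> False.
Proof.
move=> tc pm om mu mv uv pm0 om0 m0t tu tv ntu ntv.
have /pairingP[mK mN] := pm.
pose P (n : {ffun G -> G}) := [&& pairing n, #|G| + #|fixed n| <= 24 & n t == t].
have Pm0 : P m0 by rewrite /P pm0 om0 m0t eqxx.
(* Among the optimal pairings fixing [t], [n] agrees with [m] as often as possible. *)
case: (arg_maxnP (fun n : {ffun G -> G} => #|[set x | m x == n x]|) Pm0) => n /and3P[pn on /eqP nt] max.
have /pairingP[nK nN] := pn.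
have nu : n u != u.
  by apply: contraNneq tu => E; apply: (optimal_fixed_edge tc pn on nt E).
have nv : n v != v.
  by apply: contraNneq tv => E; apply: (optimal_fixed_edge tc pn on nt E).
(* Optimal pairings have equally many fixed points, and [n] moves the two fixed points [u], [v] of
   [m]; so some [x] other than [t] is fixed by [n] and moved by [m]. *)
have cardD : 1 < #|fixed n :\: fixed m|.
  have eqf : #|fixed n| = #|fixed m|.
    by have := pairing_card tc pn; have := pairing_card tc pm; move: on om; clear; lia.
  have : 1 < #|fixed m :\: fixed n|.
    by apply/card_gt1P; exists u, v; rewrite !inE nu nv mu mv !eqxx uv.
  have := cardsID (fixed n) (fixed m); have := cardsID (fixed m) (fixed n).
  by rewrite setIC eqf; clear; lia.
have [x] : exists x, x \in (fixed n :\: fixed m) :\ t.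
  apply/card_gt0P; have := cardsD1 t (fixed n :\: fixed m).
  by move: cardD; clear; case: (t \in _) => /=; lia.
rewrite !inE => /and3P[xt mx /eqP nx].
pose y := m x; pose z := n y.
have xy : x != y by rewrite eq_sym.
have ny : n y != y.
  apply: contraNneq (mN x) => E; exact: (optimal_fixed_edge tc pn on nx E).
have nz : n z = y by rewrite nK.
have zx : z != x by apply: contraNneq xy => E; rewrite -nz E nx.
have zy : z != y by [].
have ty : t != y by apply: contraNneq ny => <-; rewrite nt.
have tz : t != z by apply: contraNneq ty => E; rewrite -nz -E nt.
(* [n'] pairs [x] with [m x] and frees [z], the former mate of [y]. It stays optimal, keeps all
   agreements with [m] and gains [x]. *)
pose n' := [ffun w => if w == x then y else if w == y then x else if w == z then z else n w].
have n'x : n' x = y by rewrite ffunE eqxx.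
have n'y : n' y = x by rewrite ffunE eq_sym (negbTE xy) eqxx.
have n'z : n' z = z by rewrite ffunE (negbTE zx) (negbTE zy) eqxx.
have n'w w : w != x -> w != y -> w != z -> n' w = n w.
  by move=> wx wy wz; rewrite ffunE (negbTE wx) (negbTE wy) (negbTE wz).
have my : m y = x by rewrite mK.
have pn' : pairing n'.
  apply/pairingP; split=> w.
    case: (eqVneq w x) => [->|wx]; first by rewrite n'x n'y.
    case: (eqVneq w y) => [->|wy]; first by rewrite n'y n'x.
    case: (eqVneq w z) => [->|wz]; first by rewrite !n'z.
    rewrite (n'w w) // n'w ?nK //.
    + by apply: contraNneq wx => E; rewrite -[w]nK E nx.
    + by apply: contraNneq wz => E; rewrite -[w]nK E.
    + by apply: contraNneq wy => E; rewrite -[w]nK E nz.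
  case: (eqVneq w x) => [->|wx]; first by rewrite n'x mN.
  case: (eqVneq w y) => [->|wy]; first by rewrite n'y edge_sym mN.
  by case: (eqVneq w z) => [->|wz]; rewrite ?n'z ?edge_irr // n'w.
have fn' : fixed n' = z |: (fixed n :\ x).
  apply/setP => w; rewrite !inE; case: (eqVneq w x) => [->|wx].
    by rewrite n'x eq_sym (negbTE xy) eq_sym (negbTE zx).
  case: (eqVneq w z) => [->|wz] /=; first by rewrite n'z eqxx.
  case: (eqVneq w y) => [->|wy]; last by rewrite n'w.
  by rewrite n'y (negbTE xy) (negbTE ny).
have : P n'.
  apply/and3P; split=> //; last by rewrite n'w ?nt // eq_sym.
  have xF : x \in fixed n by rewrite inE nx.
  have zF : z \notin fixed n :\ x by rewrite !inE nz [y == z]eq_sym (negbTE zy) andbF.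
  rewrite fn' cardsU1 zF.
  by have := cardsD1 x (fixed n); rewrite xF; move: on; clear; lia.
move/max; apply/negP; rewrite -ltnNge; apply: proper_card; apply/properP; split.
  apply/subsetP => w; rewrite !inE => /eqP E.
  have wx : w != x by apply: contraNneq mx => Ew; rewrite Ew in E; rewrite E nx.
  have wy : w != y.
    by apply: contraNneq zx => Ew; rewrite Ew my in E; rewrite /z -E.
  have wz : w != z.
    apply: contraNneq zx => Ew; rewrite Ew nz in E.
    by rewrite -[z]mK E my.
  by rewrite n'w // E.
by exists x; rewrite !inE ?n'x ?eqxx // nx.
Qed.

(** To feed [pairing_exchange], let [v] be the mate of [t] in an optimal pairing fixing a
    non-neighbour [u] of [t]. A triangle through [u v] gives an optimal pairing fixing both [u] and
    [v]. *)
Lemma stability_two_contra : tricritical G ->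
  (forall x y z, x != y -> x != z -> y != z -> ~~ edge x y -> ~~ edge x z -> edge y z) ->
  False.
Proof.
move=> tc a2.
have single t : exists2 m, pairing m & m t = t /\ #|G| + #|fixed m| <= 24.
  have [c hc] := tri_vertex tc t.
  have [m pm [sub card]] := pairing_of_coloring a2 hc.
  exists m => //; split; first by have := subsetP sub t; rewrite !inE eqxx => /(_ isT)/eqP.
  by move: card; rewrite cards1.
have [t [u [tu ntu]]] : exists t u : G, t != u /\ ~~ edge t u.
  case: (boolP [exists t : G, exists u : G, (t != u) && ~~ edge t u]).
    by case/existsP => t /existsP[u /andP[]]; exists t, u.
  move/existsPn => all_edge; exfalso.
  have cT : clique [set: G].
    move=> x y _ _ xy; have /existsPn := all_edge x => /(_ y).
    by rewrite xy /= negbK.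
  pose c (x : G) := nat_of_ord (enum_rank x).
  apply: (tri_chi tc (c := c)); split=> [x _|x y _ _ xy].
    have := tri_clique tc cT; rewrite cardsT => lt12.
    by apply: leq_trans (ltn_ord _) _.
  by rewrite /c val_eqE (inj_eq enum_rank_inj) edge_neq.
have [m1 pm1 [m1u om1]] := single u.
have /pairingP[m1K m1N] := pm1.
have mt : m1 t != t.
  apply: contraNneq ntu => E; exact: (optimal_fixed_edge tc pm1 om1 E m1u).
pose v := m1 t.
have ntv : ~~ edge t v by apply: m1N.
have tv : t != v by rewrite eq_sym.
have uv : u != v by apply: contraNneq tu => E; rewrite -[t]m1K -/v -E m1u E.
have euv : edge u v by apply: (a2 t).
have [w /andP[uw vw]] := edge_in_triangle tc euv.
have [c [lt_c c_proper]] := tri_triangle tc euv uw vw.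
(* The third vertex gets its own colour; with the singletons [u] and [v] there are 12 classes. *)
pose c' x := if x == w then 9 else c x.
have hc' : colored (~: [set u; v]) 10 c'.
  have out x : x \in ~: [set u; v] -> x != w -> x \in ~: [set u; v; w].
    by rewrite !inE !negb_or => -> ->.
  split=> [x xT|x y xT yT xy]; rewrite /c'.
    by case: eqVneq => // xw; apply: ltnW; apply: lt_c; apply: out.
  case: (eqVneq x w) => [xw|xw]; case: (eqVneq y w) => [yw|yw].
  - by move: xy; rewrite xw yw edge_irr.
  - by rewrite eq_sym ltn_eqF // lt_c // out.
  - by rewrite ltn_eqF // lt_c // out.
  - by apply: c_proper; rewrite ?out.
have [m pm [sub card]] := pairing_of_coloring a2 hc'.
have mu : m u = u by have := subsetP sub u; rewrite !inE eqxx => /(_ isT)/eqP.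
have mv : m v = v by have := subsetP sub v; rewrite !inE eqxx orbT => /(_ isT)/eqP.
have om : #|G| + #|fixed m| <= 24 by move: card; rewrite cards2 uv.
have [m0 pm0 [m0t om0]] := single t.
exact: (pairing_exchange tc pm om mu mv uv pm0 om0 m0t).
Qed.

End Pairing.

(** * Stability number at least three *)

Definition stable (G : sgraph) (S : {set G}) : Prop :=
  {in S &, forall x y, ~~ edge x y}.

Definition max_stable (G : sgraph) (S : {set G}) : Prop :=
  stable S /\ forall S' : {set G}, stable S' -> #|S'| <= #|S|.

(** The partner relation: [N(s) /\ N(u)] is not a clique. *)
Definition bad (G : sgraph) (s u : G) : Prop :=
  exists p q, [/\ nonadj s p q, edge u p & edge u q].

Section LargeStability.
Variable G : sgraph.
Hypothesis tc : tricritical G.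
Implicit Types (S : {set G}) (s u v w x y z p q : G).

Lemma bad_sym s u : bad s u -> bad u s.
Proof.
by move=> [p [q [/and4P[sp sq pq npq] up uq]]]; exists p, q; rewrite /nonadj up uq pq npq.
Qed.

Lemma stable_neq S s s' w : stable S -> s \in S -> s' \in S -> edge s w -> w != s'.
Proof.
by move=> st sS s'S; apply: contraTneq => ->; apply: st.
Qed.

Lemma stable_three S s1 s2 s3 w : stable S -> s1 \in S -> s2 \in S -> s3 \in S ->
  s1 != s2 -> s1 != s3 -> s2 != s3 -> edge s1 w -> edge s2 w -> edge s3 w -> False.
Proof.
move=> st h1 h2 h3 n12 n13 n23; rewrite ![edge _ w]edge_sym => e1 e2 e3.
have := no_claw tc e1 e2 e3 n12 n13 n23 (st _ _ h1 h2) (st _ _ h1 h3).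
by rewrite (negbTE (st _ _ h2 h3)).
Qed.

(** Let [z], [z'] be non-adjacent in [N(s)] outside [N(u)]. A common neighbour [w] seeing both is
    the centre of a claw with [u]; one seeing neither lies in a claw at [s]. *)
Lemma splits_common s u : s != u -> ~~ edge s u ->
  splits (nonadj s) (nbh s :&: nbh u).
Proof.
move=> su nsu w z z' wX zX z'X zz'.
have /and4P[sz sz' nzz' ezz'] := zz'.
move: wX zX z'X; rewrite !inE sz sz' /= => /andP[sw uw] uz uz'.
apply/idP/idP => [wz|nwz'].
  by apply/negP => wz'; apply: (nonadj_triangle_free tc wz zz' wz').
apply/negPn/negP => nwz.
have wz : edge w z.
  by apply: (nonadjN sw sz _ nwz); apply: contraTneq uw => ->.
have wz' : edge w z'.
  by apply: (nonadjN sw sz' _ nwz'); apply: contraTneq uw => ->.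
have wu : edge w u by rewrite edge_sym.
have uz0 : u != z by apply: contraNneq nsu => ->.
have uz'0 : u != z' by apply: contraNneq nsu => ->.
by have := no_claw tc wu wz wz' uz0 uz'0 nzz' uz uz'; rewrite (negbTE ezz').
Qed.

Lemma disjoint_common S s u v : stable S -> s \in S -> u \in S -> v \in S ->
  s != u -> s != v -> u != v -> [disjoint nbh s :&: nbh u & nbh s :&: nbh v].
Proof.
move=> st sS uS vS su sv uv; apply/pred0P => w /=; apply/negP.
rewrite !inE => /andP[/andP[sw uw] /andP[_ vw]].
exact: (stable_three st sS uS vS su sv uv sw uw vw).
Qed.

(** Two partners would give disjoint splitting sets, each containing an [f]-edge. *)
Lemma bad_unique S s u v : stable S -> s \in S -> u \in S -> v \in S ->
  s != u -> s != v -> bad s u -> bad s v -> u = v.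
Proof.
move=> st sS uS vS su sv [p [q [pq up uq]]] [p' [q' [p'q' vp' vq']]].
apply/eqP/negPn/negP => uv.
have /and4P[sp sq _ _] := pq; have /and4P[sp' sq' _ _] := p'q'.
apply: (two_dependent_splits_contra (local_graph_nonadj tc s)
  (splits_common su (st _ _ sS uS)) (splits_common sv (st _ _ sS vS))
  (disjoint_common st sS uS vS su sv uv) _ _ pq _ _ p'q');
  by rewrite !inE ?sp ?sq ?sp' ?sq'.
Qed.

Lemma stable_exchange S s1 s2 p q : stable S -> s1 \in S -> s2 \in S ->
  ~~ edge p q ->
  (forall s, s \in S -> s != s1 -> s != s2 -> ~~ edge s p /\ ~~ edge s q) ->
  stable (S :\ s1 :\ s2 :|: [set p; q]).
Proof.
move=> st h1 h2 npq out x y; rewrite !inE.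
have nqp : ~~ edge q p by rewrite edge_sym.
move=> /orP[/and3P[x2 x1 xS]|/orP[]/eqP ->] /orP[/and3P[y2 y1 yS]|/orP[]/eqP ->];
  rewrite ?edge_irr //; rewrite ?(st _ _ xS yS) //.
- by have [] := out x xS x1 x2.
- by have [] := out x xS x1 x2.
- by rewrite edge_sym; have [] := out y yS y1 y2.
- by rewrite edge_sym; have [] := out y yS y1 y2.
Qed.

(** Replacing [s] by [x] and [y] would enlarge [S]. *)
Lemma private_clique S s x y : max_stable S -> s \in S -> nonadj s x y ->
  (forall u, u \in S -> u != s -> ~~ edge u x /\ ~~ edge u y) -> False.
Proof.
move=> [st max] sS /and4P[sx sy xy nxy] out.
have st' : stable (S :\ s :\ s :|: [set x; y]).
  by apply: stable_exchange => // u uS us _; apply: out.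
have xS : x \notin S by apply: contraTN sx => xS; apply: st.
have yS : y \notin S by apply: contraTN sy => yS; apply: st.
have := max _ st'.
have -> : S :\ s :\ s = S :\ s.
  by apply/setP => z; rewrite !inE; case: (z == s).
rewrite cardsU (_ : _ :&: _ = set0); last first.
  apply/setP => z; rewrite !inE; apply/negP => /andP[/andP[_ zS] /orP[]/eqP E];
    by rewrite E ?(negbTE xS) ?(negbTE yS) in zS.
by rewrite cards0 subn0 cards2 xy (cardsD1 s S) sS; clear; lia.
Qed.

(** By [three_splitting_edge] no [f]-edge joins two different common neighbourhoods. An edge inside
    one would be split by a vertex of another, and private neighbours form a clique. So [f] is
    bipartite between shared and private neighbours. *)
Lemma three_common_contra S s u1 u2 u3 w1 w2 w3 : max_stable S ->
  s \in S -> u1 \in S -> u2 \in S -> u3 \in S ->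
  s != u1 -> s != u2 -> s != u3 -> u1 != u2 -> u1 != u3 -> u2 != u3 ->
  w1 \in nbh s :&: nbh u1 -> w2 \in nbh s :&: nbh u2 -> w3 \in nbh s :&: nbh u3 ->
  False.
Proof.
move=> ms sS u1S u2S u3S su1 su2 su3 u12 u13 u23 w1X w2X w3X.
have st := ms.1; have lg := local_graph_nonadj tc s.
have third a b : exists u w, [/\ u \in S, s != u, u != a & u != b] /\
    w \in nbh s :&: nbh u.
  have [u [uabs [w wX]]] : exists u, [/\ u \in S, s != u, u != a & u != b] /\
      exists w, w \in nbh s :&: nbh u; last by exists u, w.
  have [/andP[a1 b1]|n1] := boolP ((u1 != a) && (u1 != b)); first by exists u1; split=> //; exists w1.
  have [/andP[a2 b2]|n2] := boolP ((u2 != a) && (u2 != b)); first by exists u2; split=> //; exists w2.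
  exists u3; split; last by exists w3.
  split=> //; rewrite !negb_and !negbK in n1 n2.
    apply/eqP => E; subst a; rewrite (negbTE u13) in n1; rewrite (negbTE u23) in n2.
    by move: n1 n2 u12 => /= /eqP -> /eqP ->; rewrite eqxx.
  apply/eqP => E; subst b; rewrite (negbTE u13) orbF in n1; rewrite (negbTE u23) orbF in n2.
  by move: n1 n2 u12 => /eqP -> /eqP ->; rewrite eqxx.
have spl u : u \in S -> s != u -> splits (nonadj s) (nbh s :&: nbh u).
  by move=> uS su; apply: splits_common => //; apply: st.
have dis u v : u \in S -> v \in S -> s != u -> s != v -> u != v ->
    [disjoint nbh s :&: nbh u & nbh s :&: nbh v].
  by move=> uS vS su sv uv; apply: (disjoint_common st).
have cross u v x y : u \in S -> v \in S -> s != u -> s != v -> u != v ->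
    x \in nbh s :&: nbh u -> y \in nbh s :&: nbh v -> nonadj s x y -> False.
  move=> uS vS su sv uv xX yX xy; have [t [w [[tS stt tu tv] wX]]] := third u v.
  by apply: (three_splitting_edge lg (spl u uS su) (spl v vS sv) (spl t tS stt)
       (dis _ _ uS vS su sv uv) _ _ xX yX wX xy); apply: dis; rewrite // eq_sym.
pose c z := [exists u in S, (s != u) && edge u z].
apply: (local_not_bipartite lg (c := c)) => x y xy; have /and4P[sx sy nxy exy] := xy.
have [/exists_inP[u uS /andP[su ux]]|cx] := boolP (c x);
  have [/exists_inP[v vS /andP[sv vy]]|cy] := boolP (c y); rewrite //; exfalso.
- have xX : x \in nbh s :&: nbh u by rewrite !inE sx.
  have yX : y \in nbh s :&: nbh v by rewrite !inE sy.
  have [uv|uv] := eqVneq u v; last exact: (cross u v x y).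
  subst v; have [t [w [[tS stt tu _] wX]]] := third u u.
  have xt : x \notin nbh s :&: nbh t by rewrite (disjointFr (dis u t _ _ _ _ _)) // eq_sym.
  have yt : y \notin nbh s :&: nbh t by rewrite (disjointFr (dis u t _ _ _ _ _)) // eq_sym.
  have := spl t tS stt _ _ _ wX xt yt xy; have [wx _|_ /esym/negbFE wy] := boolP (nonadj s w x).
    exact: (cross t u w x).
  exact: (cross t u w y).
- apply: (private_clique ms sS xy) => u uS us.
  rewrite eq_sym in us.
  move/exists_inPn: cx => /(_ u uS); move/exists_inPn: cy => /(_ u uS).
  by rewrite us /= => ? ?.
Qed.

(** Without a partner, all common neighbourhoods are cliques, at most two are non-empty by
    [three_common_contra], and the private neighbours form a third clique. *)
Lemma bad_exists S s : max_stable S -> 2 < #|S| -> s \in S ->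
  exists u, [/\ u \in S, s != u & bad s u].
Proof.
move=> ms S3 sS; have st := ms.1.
case: (boolP [exists u in S, (s != u) && [exists p, exists q,
    [&& nonadj s p q, edge u p & edge u q]]]).
  case/exists_inP => u uS /andP[su /existsP[p /existsP[q /and3P[pq up uq]]]].
  by exists u; split=> //; exists p, q.
move/exists_inPn => nobad; exfalso.
have indep u : u \in S -> s != u -> independent (nonadj s) (nbh s :&: nbh u).
  move=> uS su p q; rewrite !inE => /andP[_ up] /andP[_ uq]; apply/negP => pq.
  by have /negP := nobad u uS; rewrite su; apply; apply/existsP; exists p;
     apply/existsP; exists q; rewrite pq up uq.
pose J := [set u in S :\ s | nbh s :&: nbh u != set0].
have JS u : u \in J -> [/\ u \in S, s != u & exists w, w \in nbh s :&: nbh u].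
  rewrite !inE => /andP[/andP[us uS] /set0Pn ex]; split=> //; first by rewrite eq_sym.
have J2 : #|J| <= 2.
  rewrite leqNgt; apply/negP => /card_gt2P[u1 [u2 [u3 [[h1 h2 h3] [n12 n23 n31]]]]].
  have [s1 su1 [w1 w1X]] := JS _ h1; have [s2 su2 [w2 w2X]] := JS _ h2.
  have [s3 su3 [w3 w3X]] := JS _ h3.
  by apply: (three_common_contra ms sS s1 s2 s3 su1 su2 su3 n12 _ n23 w1X w2X w3X); rewrite eq_sym.
have cS : 2 <= #|S :\ s| by move: S3; rewrite (cardsD1 s S) sS.
have [u1 [u2 [[u1S u2S u12] JU]]] : exists u1 u2,
    [/\ u1 \in S :\ s, u2 \in S :\ s & u1 != u2] /\ J \subset [set u1; u2].
  have [J0|[u1 u1J]] := set_0Vmem J.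
    case/card_gt1P: cS => u1 [u2 [? ? ?]]; exists u1, u2; split=> //.
    by rewrite J0 sub0set.
  have u1S : u1 \in S :\ s by move: u1J; rewrite inE => /andP[].
  have [J1|[u2]] := set_0Vmem (J :\ u1).
    have [u2] : exists u2, u2 \in S :\ s :\ u1.
      by apply/card_gt0P; move: cS; rewrite (cardsD1 u1 (S :\ s)) u1S.
    rewrite in_setD1 => /andP[u21 u2S]; exists u1, u2; rewrite eq_sym; split=> //.
    apply/subsetP => z zJ; rewrite !inE; apply/orP; left; apply/negPn/negP => zu.
    by have := in_set0 z; rewrite -J1 !inE zu; move: zJ; rewrite !inE => ->.
  rewrite in_setD1 => /andP[u21 u2J].
  have u2S : u2 \in S :\ s by move: u2J; rewrite inE => /andP[].
  exists u1, u2; rewrite eq_sym; split=> //.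
  have : #|J :\ u1 :\ u2| = 0.
    have := cardsD1 u1 J; have := cardsD1 u2 (J :\ u1).
    by rewrite in_setD1 u21 u1J u2J; move: J2; clear; lia.
  move/cards0_eq => J0; apply/subsetP => z zJ; rewrite !inE.
  by have := in_set0 z; rewrite -J0 !in_setD1 zJ andbT; do 2!case: (z == _).
move: u1S u2S; rewrite !inE => /andP[u1s u1S] /andP[u2s u2S].
rewrite eq_sym in u1s; rewrite eq_sym in u2s.
apply: (three_parts_contra (local_graph_nonadj tc s)
          (X1 := nbh s :&: nbh u1) (X2 := nbh s :&: nbh u2)); split.
- exact: subsetIl.
- exact: subsetIl.
- by apply: splits_common => //; apply: st.
- by apply: splits_common => //; apply: st.
- exact: (disjoint_common st).
- exact: indep.
- exact: indep.
move=> x y xR yR; apply/negP => xy; have /and4P[sx sy _ _] := xy.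
apply: (private_clique ms sS xy) => u uS us.
have key z : z \in rest (nbh s) (nbh s :&: nbh u1) (nbh s :&: nbh u2) -> edge s z -> ~~ edge u z.
  move=> zR sz; apply/negP => uz.
  have : u \in J by rewrite !inE us uS; apply/set0Pn; exists z; rewrite !inE sz.
  move/(subsetP JU); move: zR; rewrite !inE sz => /=; rewrite andbT negb_or => /andP[z1 z2].
  by case/orP => /eqP E; subst u; [case/negP: z1 | case/negP: z2].
by split; apply: key.
Qed.

(** A third neighbour of [p] or [q] in [S] would create a claw. *)
Lemma max_stable_swap2 S s0 s1 p q : max_stable S -> s0 \in S -> s1 \in S -> s0 != s1 ->
  nonadj s0 p q -> edge s1 p -> edge s1 q ->
  max_stable (S :\ s0 :\ s1 :|: [set p; q]).
Proof.
move=> [st max] s0S s1S s01 /and4P[s0p s0q pq npq] s1p s1q; split.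
  apply: stable_exchange => // s sS ss0 ss1.
  have s0s : s0 != s by rewrite eq_sym.
  have s1s : s1 != s by rewrite eq_sym.
  by split; apply/negP => e; apply: (stable_three st s0S s1S sS s01 s0s s1s _ _ e).
have -> : #|S :\ s0 :\ s1 :|: [set p; q]| = #|S|; last exact: max.
have pS : p \notin S by apply: contraTN s0p => pS; apply: st.
have qS : q \notin S by apply: contraTN s0q => qS; apply: st.
rewrite cardsU (_ : _ :&: _ = set0); last first.
  apply/setP => z; rewrite !inE; apply/negP => /andP[/and3P[_ _ zS] /orP[]/eqP E];
    by rewrite E ?(negbTE pS) ?(negbTE qS) in zS.
have := cardsD1 s0 S; have := cardsD1 s1 (S :\ s0).
rewrite in_setD1 eq_sym s01 s0S s1S cards0 subn0 cards2 pq; clear; lia.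
Qed.

(* If the common neighbourhood of [s0], [s2] is a clique, then for [y] in it the
   sets [N(y) - N[s2]], [N(y) - N[s0]] and [N(y) :&: N(s0) :&: N(s2)] are cliques,
   and no vertex of the third one misses vertices of both others. *)
Lemma link_bad S s0 s2 y : max_stable S -> 2 < #|S| -> s0 \in S -> s2 \in S -> s0 != s2 ->
  edge s0 y -> edge s2 y -> bad s0 s2.
Proof.
move=> ms S3 s0S s2S s02 s0y s2y; have st := ms.1.
have [s1 [s1S s01 b01]] := bad_exists ms S3 s0S.
have [E|n12] := eqVneq s1 s2; first by rewrite -E.
have [s3 [s3S s23 b23]] := bad_exists ms S3 s2S.
have [E|n30] := eqVneq s3 s0; first by apply: bad_sym; rewrite -E.
have n31 : s3 != s1.
  apply/eqP => E; subst s3.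
  have := bad_unique st s1S s0S s2S _ _ (bad_sym b01) (bad_sym b23).
  by rewrite ![s1 == _]eq_sym s01 s23 => /(_ isT isT) E; rewrite E eqxx in s02.
case: (boolP [exists p, exists q, [&& nonadj s0 p q, edge s2 p & edge s2 q]]).
  by case/existsP => p /existsP[q /and3P[pq s2p s2q]]; exists p, q.
move/existsPn => nb02; exfalso.
have s20 : s2 != s0 by rewrite eq_sym.
have s10 : s1 != s0 by rewrite eq_sym.
have n21 : s2 != s1 by rewrite eq_sym.
have e02 := st _ _ s0S s2S; have e20 := st _ _ s2S s0S.
have e01 := st _ _ s0S s1S.
have [p0 [_ [/and4P[s2p0 _ _ _] s3p0 _]]] := b23.
have ys0 : edge y s0 by rewrite edge_sym.
have ys2 : edge y s2 by rewrite edge_sym.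
pose in0 z := (z != s2) && ~~ edge s2 z.
pose in2 z := (z != s0) && ~~ edge s0 z.
have not02 z : edge y z -> in0 z -> in2 z -> False.
  move=> yz /andP[z2 e2] /andP[z0 e0].
  have := no_claw tc ys0 ys2 yz s02 _ _ e02 e0; rewrite (negbTE e2).
  by rewrite ![_ == z]eq_sym z0 z2 => /(_ isT isT).
have key c a a' : edge s0 c -> edge s2 c -> nonadj y c a -> nonadj y c a' ->
    in0 a -> in2 a' -> False.
  move=> s0c s2c ca ca' /andP[a2 e2a] /andP[a'0 e0a'].
  have /and4P[yc ya nca eca] := ca; have /and4P[_ ya' nca' eca'] := ca'.
  have a0 : a != s0 by apply: contraNneq eca => ->; rewrite edge_sym.
  have a'2 : a' != s2 by apply: contraNneq eca' => ->; rewrite edge_sym.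
  have s0a : edge s0 a.
    by apply: (no_claw tc ys2 ys0 ya) => //; rewrite eq_sym.
  have s2a' : edge s2 a'.
    by apply: (no_claw tc ys0 ys2 ya') => //; rewrite eq_sym.
  have aa' : a != a' by apply: contraNneq e2a => ->.
  have eaa' : edge a a'.
    apply: (nonadjN ya ya' aa'); apply/negP => naa'.
    exact: (nonadj_triangle_free tc ca naa' ca').
  have e1a' : ~~ edge s1 a'.
    apply/negP => e1a'.
    apply: (three_common_contra (w1 := y) (w2 := p0) (w3 := a') ms s2S s0S s3S s1S) => //;
      rewrite ?inE ?s2y ?s2p0 ?s2a' //; by rewrite eq_sym.
  have a'1 : a' != s1 by apply: (stable_neq st s2S s1S).
  have e1a : ~~ edge s1 a.
    apply/negP => e1a.
    have as0 : edge a s0 by rewrite edge_sym.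
    have as1 : edge a s1 by rewrite edge_sym.
    have := no_claw tc as0 as1 eaa' s01 _ _ e01 e0a'.
    by rewrite ![_ == a']eq_sym a'0 a'1 (negbTE e1a') => /(_ isT isT).
  have e1y : ~~ edge s1 y.
    by apply/negP => e; apply: (stable_three st s0S s2S s1S s02 s01 n21 s0y s2y e).
  have e1c : ~~ edge s1 c.
    by apply/negP => e; apply: (stable_three st s0S s2S s1S s02 s01 n21 s0c s2c e).
  (* [y] sees one of the two, or [s0] is the centre of a claw; that one is named [p]. *)
  have [p [q [pq [s1p s1q] yp]]] : exists p q,
      [/\ nonadj s0 p q, edge s1 p /\ edge s1 q & edge p y].
    case: b01 => p [q [pq s1p s1q]]; have /and4P[s0p s0q npq epq] := pq.
    have py : p != y by apply: contraNneq e1y => <-.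
    have qy : q != y by apply: contraNneq e1y => <-.
    have [yp|nyp] := boolP (edge p y); first by exists p, q.
    exists q, p; rewrite nonadj_sym; split=> //.
    exact: (no_claw tc s0p s0q s0y npq py qy epq nyp).
  have /and4P[s0p s0q npq epq] := pq.
  have e2p : ~~ edge s2 p.
    by apply/negP => e; apply: (stable_three st s0S s1S s2S s01 s02 n12 s0p s1p e).
  have e2q : ~~ edge s2 q.
    by apply/negP => e; apply: (stable_three st s0S s1S s2S s01 s02 n12 s0q s1q e).
  have not1 w r : edge s1 r -> ~~ edge s1 w -> r != w.
    by move=> h; apply: contraNneq => <-.
  have notboth w : edge w p -> edge w q -> edge w s2 -> False.
    move=> wp wq ws2; have := no_claw tc ws2 wp wq _ _ npq e2p e2q.
    rewrite (negbTE epq) ![s2 == _]eq_sym.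
    by rewrite (stable_neq st s0S s2S s0p) (stable_neq st s0S s2S s0q) => /(_ isT isT).
  have oneof w : edge s0 w -> ~~ edge s1 w -> ~~ edge p w -> edge q w.
    move=> s0w s1w npw.
    exact: (no_claw tc s0p s0q s0w npq (not1 _ _ s1p s1w) (not1 _ _ s1q s1w) epq npw).
  have nqy : ~~ edge q y.
    by apply/negP => qy; apply: (notboth y); rewrite 1?edge_sym.
  have cp : edge p c.
    apply/negPn/negP => ncp; have cq := oneof c s0c e1c ncp.
    (* After the swap [s2] shares [y] with [p], [c] with [q] and [p0] with [s3]. *)
    have ms' := max_stable_swap2 ms s0S s1S s01 pq s1p s1q.
    apply: (three_common_contra (s := s2) (u1 := p) (u2 := q) (u3 := s3)
              (w1 := y) (w2 := c) (w3 := p0) ms'); rewrite ?inE ?eqxx ?orbT //.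
    - by rewrite n21 s20 s2S.
    - by rewrite n31 n30 s3S.
    - by rewrite eq_sym (stable_neq st s0S s2S s0p).
    - by rewrite eq_sym (stable_neq st s0S s2S s0q).
    - exact: (stable_neq st s0S s3S s0p).
    - exact: (stable_neq st s0S s3S s0q).
    - by rewrite s2y.
    - by rewrite s2c.
    - by rewrite s2p0.
  have ncq : ~~ edge q c.
    by apply/negP => cq; apply: (notboth c); rewrite 1?edge_sym.
  have npa' : ~~ edge p a'.
    apply/negP => pa'.
    have ps0 : edge p s0 by rewrite edge_sym.
    have ps1 : edge p s1 by rewrite edge_sym.
    have := no_claw tc ps0 ps1 pa' s01 _ _ e01 e0a'.
    by rewrite ![_ == a']eq_sym a'0 a'1 (negbTE e1a') => /(_ isT isT).
  have nqa' : ~~ edge q a'.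
    apply/negP => qa'.
    have qs0 : edge q s0 by rewrite edge_sym.
    have qs1 : edge q s1 by rewrite edge_sym.
    have := no_claw tc qs0 qs1 qa' s01 _ _ e01 e0a'.
    by rewrite ![_ == a']eq_sym a'0 a'1 (negbTE e1a') => /(_ isT isT).
  have nqa : ~~ edge q a.
    apply/negP => qa.
    have aq : edge a q by rewrite edge_sym.
    have npa : ~~ edge p a.
      apply/negP => pa; have ap : edge a p by rewrite edge_sym.
      have pa'0 : p != a' by apply: not1.
      have qa'0 : q != a' by apply: not1.
      by have := no_claw tc ap aq eaa' npq pa'0 qa'0 epq npa'; rewrite (negbTE nqa').
    have yp' : edge y p by rewrite edge_sym.
    have ps2 : p != s2 by apply: (stable_neq st s0S s2S).
    have := no_claw tc yp' ys2 ya ps2 (not1 _ _ s1p e1a) _ _ npa.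
    by rewrite (negbTE e2a) edge_sym e2p eq_sym a2 => /(_ isT isT).
  (* [q], [a], [c] are now pairwise non-adjacent neighbours of [s0]. *)
  have := no_claw tc s0q s0a s0c (not1 _ _ s1q e1a) (not1 _ _ s1q e1c) _ nqa ncq.
  by rewrite eq_sym edge_sym (negbTE eca) nca => /(_ isT).
have clique0 x z : in0 x -> in0 z -> nonadj y x z -> False.
  move=> /andP[x2 e2x] /andP[z2 e2z] /and4P[yx yz xz exz].
  have := no_claw tc ys2 yx yz _ _ xz e2x e2z; rewrite (negbTE exz).
  by rewrite ![s2 == _]eq_sym x2 z2 => /(_ isT isT).
have clique2 x z : in2 x -> in2 z -> nonadj y x z -> False.
  move=> /andP[x0 e0x] /andP[z0 e0z] /and4P[yx yz xz exz].
  have := no_claw tc ys0 yx yz _ _ xz e0x e0z; rewrite (negbTE exz).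
  by rewrite ![s0 == _]eq_sym x0 z0 => /(_ isT isT).
have inC z : ~~ in0 z -> ~~ in2 z -> edge s0 z && edge s2 z.
  rewrite !negb_and !negbK => /orP[/eqP ->|h2] /orP[/eqP E|h0].
  - by rewrite E eqxx in s20.
  - by rewrite (negbTE e02) in h0.
  - by rewrite E (negbTE e20) in h2.
  - by rewrite h0 h2.
(* A common neighbour of [s0] and [s2] joins the clique [in0] unless it misses one of its vertices;
   [key] then forbids it to miss any vertex of [in2]. *)
pose c z := in0 z || ~~ in2 z && ~~ [exists a, in0 a && nonadj y z a].
have cE x z : nonadj y x z -> c x -> c z -> False.
  have half u w : nonadj y u w -> in0 u -> ~~ [exists a, in0 a && nonadj y w a] -> False.
    by move=> uw u0 /existsPn/(_ u); rewrite u0 nonadj_sym uw.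
  move=> xz /orP[x0|/andP[x2 xn]] /orP[z0|/andP[z2 zn]].
  - exact: (clique0 x z).
  - exact: (half x z).
  - by apply: (half z x) => //; rewrite nonadj_sym.
  - have [x0|x0] := boolP (in0 x); first exact: (half x z).
    have [z0|z0] := boolP (in0 z); first by apply: (half z x) => //; rewrite nonadj_sym.
    have /andP[s0x s2x] := inC x x0 x2; have /andP[s0z s2z] := inC z z0 z2.
    have /existsPn/(_ z) := nb02 x; rewrite s2x s2z /nonadj s0x s0z.
    by move/and4P: xz => [_ _ -> ->].
have cN x z : nonadj y x z -> ~~ c x -> ~~ c z -> False.
  have notc u : ~~ c u -> ~~ in0 u /\ (in2 u \/ exists2 a, in0 a & nonadj y u a).
    rewrite /c negb_or negb_and !negbK => /andP[u0 /orP[u2|/existsP[a /andP[a0 ua]]]];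
      split=> //; by [left | right; exists a].
  have half u w : nonadj y u w -> ~~ in0 u -> in2 w ->
      (exists2 a, in0 a & nonadj y u a) -> False.
    move=> uw u0 w2 [a a0 ua].
    have [u2|u2] := boolP (in2 u); first exact: (clique2 u w).
    have /andP[s0u s2u] := inC u u0 u2.
    exact: (key u a w).
  move=> xz /notc[x0 hx] /notc[z0 hz]; have zx : nonadj y z x by rewrite nonadj_sym.
  have [x2|x2] := boolP (in2 x); have [z2|z2] := boolP (in2 z).
  - exact: (clique2 x z).
  - by case: hz => [h|ex]; [rewrite h in z2 | apply: (half z x)].
  - by case: hx => [h|ex]; [rewrite h in x2 | apply: (half x z)].
  - have /andP[s0x s2x] := inC x x0 x2; have /andP[s0z s2z] := inC z z0 z2.
    have /existsPn/(_ z) := nb02 x; rewrite s2x s2z /nonadj s0x s0z.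
    by move/and4P: xz => [_ _ -> ->].
apply: (local_not_bipartite (local_graph_nonadj tc y) (c := c)) => x z xz.
apply/negP => /eqP E; have [cx|cx] := boolP (c x).
  by apply: (cE x z) => //; rewrite -E.
by apply: (cN x z) => //; rewrite -E.
Qed.

(** If no edge left [A], an 11-colouring of [G - y] used on [A] and one of [G - x] used off [A]
    would combine. *)
Lemma connected_cut (A : {set G}) x y : x \in A -> y \notin A ->
  exists z z', [/\ z \in A, z' \notin A & edge z z'].
Proof.
move=> xA yA.
case: (boolP [exists z in A, exists z', (z' \notin A) && edge z z']).
  by case/exists_inP => z zA /existsP[z' /andP[z'A zz']]; exists z, z'.
move/exists_inPn => cut; exfalso.
have nocross z z' : z \in A -> z' \notin A -> ~~ edge z z'.
  by move=> zA z'A; have /existsPn/(_ z') := cut z zA; rewrite z'A.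
have [cx [ltx px]] := tri_vertex tc x; have [cy [lty py]] := tri_vertex tc y.
have inA z : z \in A -> z \in ~: [set y] by move=> zA; rewrite !inE; apply: contraTneq zA => ->.
have outA z : z \notin A -> z \in ~: [set x] by rewrite !inE; apply: contraNneq => ->.
apply: (tri_chi tc (c := fun z => if z \in A then cy z else cx z)); split=> [z _|z z' _ _ zz'].
  by have [zA|zA] := boolP (z \in A); [apply/lty/inA | apply/ltx/outA].
have [zA|zA] := boolP (z \in A); have [z'A|z'A] := boolP (z' \in A).
- by apply: py; rewrite ?inA.
- by rewrite (negbTE (nocross _ _ zA z'A)) in zz'.
- by rewrite edge_sym (negbTE (nocross _ _ z'A zA)) in zz'.
- by apply: px; rewrite ?outA.
Qed.

(** Take an edge [z z'] leaving the closed neighbourhoods of partners [s0], [s1], with [z] adjacent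
    to [s0], say. Replacing [s0] by [z] keeps the stable set maximum, and a neighbour [s2] of [z']
    in it gets [z] as a second partner besides [s3]. *)
Lemma stability_three_contra S : max_stable S -> 2 < #|S| -> False.
Proof.
move=> ms S3; have st := ms.1.
have [s0 s0S] : exists s0, s0 \in S by apply/card_gt0P; apply: leq_trans S3.
have [s1 [s1S s01 b01]] := bad_exists ms S3 s0S.
have [t tS] : exists t, t \in S :\ s0 :\ s1.
  apply/card_gt0P; have := cardsD1 s0 S; have := cardsD1 s1 (S :\ s0).
  by rewrite in_setD1 eq_sym s01 s0S s1S; move: S3; clear; lia.
move: tS; rewrite !inE => /and3P[t1 t0 tS].
pose A := [set z | [|| z == s0, z == s1, edge s0 z | edge s1 z]].
have s0A : s0 \in A by rewrite inE eqxx.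
have tA : t \notin A.
  by rewrite inE !negb_or t0 t1 (negbTE (st _ _ s0S tS)) (negbTE (st _ _ s1S tS)).
have [z [z' [zA z'A zz']]] := connected_cut s0A tA.
move: z'A; rewrite inE !negb_or => /and4P[z'0 z'1 e0z' e1z'].
have {zA} : edge s0 z || edge s1 z.
  move: zA; rewrite inE => /or4P[/eqP E|/eqP E|->|->]; rewrite ?orbT //.
    by rewrite -E zz' in e0z'.
  by rewrite -E zz' in e1z'.
move: s0 s1 s0S s1S s01 b01 {t t0 t1 tS tA A s0A} z'0 z'1 e0z' e1z'.
suff main s0 s1 : s0 \in S -> s1 \in S -> s0 != s1 -> bad s0 s1 -> z' != s0 -> z' != s1 ->
    ~~ edge s0 z' -> ~~ edge s1 z' -> edge s0 z -> False.
  move=> s0 s1 s0S s1S s01 b01 z'0 z'1 e0 e1 /orP[h|h].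
    exact: (main s0 s1).
  by apply: (main s1 s0) => //; [rewrite eq_sym | apply: bad_sym].
move=> s0S s1S s01 b01 z'0 z'1 e0z' e1z' s0z.
have zs0 : edge z s0 by rewrite edge_sym.
have e1z : ~~ edge s1 z.
  apply/negP => s1z; have zs1 : edge z s1 by rewrite edge_sym.
  have := no_claw tc zs0 zs1 zz' s01 _ _ (st _ _ s0S s1S) e0z'.
  by rewrite ![_ == z']eq_sym z'0 z'1 (negbTE e1z') => /(_ isT isT).
(* By [link_bad], another member of [S] seeing [z] is a partner of [s0], hence equals [s1], which
   misses [z]. *)
have private s : s \in S -> s != s0 -> ~~ edge s z.
  move=> sS ss0; apply/negP => sz; have s0s : s0 != s by rewrite eq_sym.
  have b := link_bad ms S3 s0S sS s0s s0z sz.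
  have E := bad_unique st s0S s1S sS s01 s0s b01 b.
  by rewrite E sz in e1z.
have zS : z \notin S by apply: contraTN s0z => zS; apply: st.
have z'S : z' \notin S.
  by apply/negP => z'S; have := private z' z'S z'0; rewrite edge_sym zz'.
have [s2 s2S s2z'] : exists2 s2, s2 \in S & edge s2 z'.
  case: (boolP [exists s2 in S, edge s2 z']) => [/exists_inP //|/exists_inPn no].
  have : stable (z' |: S).
    move=> x y; rewrite !inE => /orP[/eqP ->|xS] /orP[/eqP ->|yS].
    - by rewrite edge_irr.
    - by rewrite edge_sym; apply: no.
    - exact: no.
    - exact: st.
  by move/(ms.2 _); rewrite cardsU1 z'S ltnn.
have s20 : s2 != s0 by apply: contraNneq e0z' => <-.
have s21 : s2 != s1 by apply: contraNneq e1z' => <-.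
have s02 : s0 != s2 by rewrite eq_sym.
have [s3 [s3S s23 b23]] := bad_exists ms S3 s2S.
have s30 : s3 != s0.
  apply/eqP => E; subst s3.
  by have E := bad_unique st s0S s1S s2S s01 s02 b01 (bad_sym b23); rewrite E eqxx in s21.
pose S1 := z |: (S :\ s0).
have cS1 : #|S1| = #|S|.
  by rewrite /S1 cardsU1 !inE (negbTE zS) andbF (cardsD1 s0 S) s0S.
have ms1 : max_stable S1.
  split; last by rewrite cS1; apply: ms.2.
  move=> x y; rewrite !inE => /orP[/eqP ->|/andP[x0 xS]] /orP[/eqP ->|/andP[y0 yS]].
  - by rewrite edge_irr.
  - by rewrite edge_sym; apply: private.
  - exact: private.
  - exact: st.
have S13 : 2 < #|S1| by rewrite cS1.
have zS1 : z \in S1 by rewrite !inE eqxx.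
have s2S1 : s2 \in S1 by rewrite !inE s20 s2S orbT.
have s3S1 : s3 \in S1 by rewrite !inE s30 s3S orbT.
have zs2 : z != s2 by apply: contraNneq zS => ->.
have s2z : s2 != z by rewrite eq_sym.
have bz := link_bad ms1 S13 zS1 s2S1 zs2 zz' s2z'.
have E := bad_unique ms1.1 s2S1 zS1 s3S1 s2z s23 (bad_sym bz) b23.
by rewrite E s3S in zS.
Qed.

Lemma tricritical_contra : False.
Proof.
have [/existsP[x /existsP[y /existsP[z /and4P[xy xz yz]]]]|/existsPn no] :=
  boolP [exists x : G, exists y : G, exists z : G, [&& x != y, x != z, y != z &
    [&& ~~ edge x y, ~~ edge x z & ~~ edge y z]]].
  case/and3P => nxy nxz nyz.
  pose stableb S := [forall u in S, forall v in S, ~~ edge u v].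
  have stP S : reflect (stable S) (stableb S).
    apply: (iffP forall_inP) => [h u v uS vS|h u uS].
      by have /forall_inP := h u uS; apply.
    by apply/forall_inP => v vS; apply: h.
  have st3 : stableb (x |: [set y; z]).
    apply/stP => u v; rewrite !inE => /or3P[] /eqP -> /or3P[] /eqP ->;
      rewrite ?edge_irr //; by rewrite edge_sym.
  case: (arg_maxnP (fun S : {set G} => #|S|) st3) => S /stP st max.
  apply: (@stability_three_contra S); first by split=> // S' /stP/max.
  apply: leq_trans (max _ st3).
  by rewrite cardsU1 cards2 !inE negb_or xy xz yz.
apply: (stability_two_contra tc) => x y z xy xz yz nxy nxz.
apply/negPn/negP => nyz; have /existsPn/(_ y)/existsPn/(_ z) := no x.
by rewrite xy xz yz nxy nxz nyz.
Qed.

End LargeStability.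

(** * Conclusion *)

Lemma critical_colored (G : sgraph) k (v : G) : critical G -> chi G = k.+1 ->
  exists c, colored (~: [set v]) k c.
Proof.
move=> crit chiG; have [c hc] := chi_remove_colored [set v].
by exists c; have := crit v; rewrite chiG addn1 => -[<-].
Qed.

(** A vertex [v] outside [K] would leave [K] inside the [k]-colourable graph [G - v], so [K] is the
    whole vertex set. *)
Lemma clique_isomorphic (G : sgraph) k (K : {set G}) :
  critical G -> chi G = k.+1 -> clique K -> k < #|K| -> isomorphic G (complete k.+1).
Proof.
move=> crit chiG cK ltK.
have KT : K = [set: G].
  apply/setP => v; rewrite in_setT; apply/negPn/negP => vK.
  have [c hc] := critical_colored v crit chiG.
  have := clique_chi cK _ hc; rewrite leqNgt ltK => /(_ _)/notF; apply.
  by apply/subsetP => x xK; rewrite !inE; apply: contraTneq xK => ->.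
have [v _] : exists v, v \in K by apply/card_gt0P; apply: leq_trans ltK.
have cardG : #|G| = k.+1.
  apply/eqP; rewrite eqn_leq -{2}cardsT -KT ltK andbT.
  have [c hc] := critical_colored v crit chiG.
  have cK' : clique (~: [set v]) by move=> x y _ _; apply: cK; rewrite KT in_setT.
  have := clique_chi cK' (subxx _) hc.
  by have := cardsC [set v]; rewrite cards1; clear; lia.
exists (fun x : G => cast_ord cardG (enum_rank x)); split.
  apply: (Bijective (g := fun i => enum_val (cast_ord (esym cardG) i))) => i.
    by rewrite cast_ordK enum_rankK.
  by rewrite enum_valK cast_ordKV.
move=> x y; rewrite {1}/edge /= /complete_rel (inj_eq (@cast_ord_inj _ _ cardG)).
rewrite (inj_eq enum_rank_inj); apply/idP/idP; last exact: edge_neq.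
by apply: cK; rewrite KT in_setT.
Qed.

Lemma triangle_colored (G : sgraph) k (a b c : G) :
  triangle_critical G -> chi G = k + 3 -> edge a b -> edge a c -> edge b c ->
  exists col, colored (~: [set a; b; c]) k col.
Proof.
move=> [_ _ crit3] chiG ab ac bc.
pose f (i : complete 3) : G := nth a [:: a; b; c] i.
have uniq_abc : uniq [:: a; b; c].
  by rewrite /= !inE negb_or !edge_neq.
have emb : subgraph_embedding f.
  split=> [i j E|].
    by apply/val_inj/eqP; rewrite -(nth_uniq a _ _ uniq_abc) ?ltn_ord // -/(f i) E.
  have sym := edge_sym (s := G).
  by case=> -[|[|[|//]]] hi [[|[|[|//]]] hj] //=; rewrite /f /= // sym.
have imE : f @: [set: complete 3] = [set a; b; c].
  apply/setP => x; rewrite !inE; apply/imsetP/idP.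
    by case=> -[[|[|[|//]]] hi] _ ->; rewrite /f /= eqxx ?orbT.
  move=> /orP[/orP[]|] /eqP ->.
  - by exists (inord 0); rewrite ?in_setT // /f inordK.
  - by exists (inord 1); rewrite ?in_setT // /f inordK.
  - by exists (inord 2); rewrite ?in_setT // /f inordK.
have [col hc] := chi_remove_colored [set a; b; c].
by exists col; have := crit3 f emb; rewrite imE chiG => /addIn <-.
Qed.

Theorem theorem8 (G : sgraph) (hcrit : triangle_critical G)
    (hclaw : claw_free G) (hchi : chi G = 12) :
  isomorphic G (complete 12).
Proof.
have [_ crit _] := hcrit.
have [/existsP[K /andP[/forall_inP cK ltK]]|/existsPn noK] := boolP [exists K : {set G},
    [forall x in K, forall y in K, (x != y) ==> edge x y] && (11 < #|K|)].
  apply: (clique_isomorphic crit hchi (K := K)) => // x y xK yK.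
  by have /forall_inP/(_ y yK)/implyP := cK x xK.
exfalso; apply: (@tricritical_contra G); split=> //.
- by move=> c /chi_le; rewrite hchi.
- by move=> v; apply: critical_colored.
- by move=> a b c; apply: triangle_colored.
move=> K cK; rewrite ltnNge; apply/negP => ltK.
have /negP := noK K; apply; rewrite ltK andbT.
apply/forall_inP => x xK; apply/forall_inP => y yK; apply/implyP; exact: cK.
Qed.
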